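(* The theory $\Theta=\{\vartheta\in\mathcal F_{()}\mid\mathbb C\models\vartheta\}$ is complete and decidable. The pseudo-complex quantifier elimination procedure yields a decision procedure for $\Theta$.
   Context: Language and terms. The language $\mathcal L$ has the function symbols: a constant $q$ for every rational $q\ge 0$, a constant $\mathrm i$, binary $+$ and $\cdot$, unary $-$, and unary $\Re$, $\Im$, $\overline{\,\cdot\,}$; and the binary relation symbols $<,\le,\ne$. Equality $=$ is a logical symbol. $\mathcal V$ is a fixed countably infinite strictly ordered set of variables, and terms are built from $\mathcal L$ and $\mathcal V$ as usual. A term in variables $z_1,\dots,z_n$ induces a function $\mathbb C^n\to\mathbb C$ by interpreting the symbols in the usual way ($\mathrm i$ as the imaginary unit, $\Re,\Im$ as real and imaginary part, $\overline{\,\cdot\,}$ as complex conjugation). It is a real term if this function takes only real values. Formulas. Atoms are $t_1=t_2$, $t_1\ne t_2$ with $t_1,t_2$ arbitrary terms, and $r_1\le r_2$, $r_1<r_2$ with $r_1,r_2$ real terms. Quantifier-free formulas are built from atoms, $\top$, $\bot$ using $\lnot$, $\land$, $\lor$ (arbitrary arity), $\longrightarrow$, $\longleftrightarrow$. Prenex first-order formulas are obtained from quantifier-free formulas by prefixing quantifiers $\exists z,\forall z$ with $z\in\mathcal V$. $\mathcal F_{()}$ is the set of prenex sentences, i.e. prenex first-order formulas without free variables. Formulas are interpreted in the usual way with variables and quantifiers ranging over $\mathbb C$, where $<,\le$ are the usual order on the real values of real terms; $\mathbb C\models\vartheta$ means that $\vartheta$ is true. Complete means that for every $\vartheta\in\mathcal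 F_{()}$ either $\vartheta\in\Theta$ or $\lnot\vartheta\in\Theta$ (where $\lnot\vartheta$ is identified with an equivalent prenex sentence obtained by moving the negation inside the quantifiers). Decidable means that there is an algorithm which, given $\vartheta\in\mathcal F_{()}$, decides whether $\vartheta\in\Theta$. Pseudo-complex quantifier elimination procedure. Given a formula, first rewrite it into an equivalent formula $\varphi$ in real normal form, i.e. one in which every atom has right-hand side $0$ and left-hand side a polynomial with rational coefficients in the expressions $\Re(z_i),\Im(z_i)$, where the $z_i$ are the (free or bound) variables of $\varphi$. Then: (1) replace each subterm $\Re(z_i)$, $\Im(z_i)$ by an auxiliary variable $z_i^{\Re}$, $z_i^{\Im}$, and each quantifier $\exists z_i$, $\forall z_i$ by $\exists z_i^{\Re}\exists z_i^{\Im}$, $\forall z_i^{\Re}\forall z_i^{\Im}$, obtaining a formula $\psi$ in the language of ordered rings (with rational constants); (2) apply any real quantifier elimination procedure to obtain a quantifier-free $\psi'$, with variables among the free variables of $\psi$, such that $\mathbb R\models\psi\longleftrightarrow\psi'$; (3) substitute $\Re(z_i)$ for $z_i^{\Re}$ and $\Im(z_i)$ for $z_i^{\Im}$ in $\psi'$, obtaining the quantifier-free output formula $\varphi'$. *)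

(* Defs.v *)
From HB Require Import structures.
From mathcomp Require Import all_boot all_order all_algebra.
From mathcomp Require Import reals complex.

Set Implicit Arguments.
Unset Strict Implicit.
Unset Printing Implicit Defensive.

Import Order.TTheory GRing.Theory Num.Theory.
Local Open Scope ring_scope.

(** ** Formulas over an arbitrary type of terms *)

Inductive relsym := Eq | Ne | Le | Lt.

Inductive qform (T : Type) :=
| Atom (r : relsym) (t1 t2 : T)
| Top
| Bot
| Neg (f : qform T)
| And (fs : seq (qform T))
| Or (fs : seq (qform T))
| Imp (f g : qform T)
| Iff (f g : qform T).
Arguments Top {T}.
Arguments Bot {T}.

Inductive quantifier := Ex | All.

(* [Prenex [:: (q1, v1); ...; (qn, vn)] m] is q1 v1 ... qn vn, m. *)
Record prenex (V T : Type) := Prenex {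
  quants : seq (quantifier * V);
  body : qform T }.

Fixpoint qall (T : Type) (P : relsym -> T -> T -> Prop) (f : qform T) : Prop :=
  match f with
  | Atom r t1 t2 => P r t1 t2
  | Top | Bot => True
  | Neg f1 => qall P f1
  | And fs | Or fs => foldr (fun f1 Q => qall P f1 /\ Q) True fs
  | Imp f1 f2 | Iff f1 f2 => qall P f1 /\ qall P f2
  end.

Fixpoint qmap (T U : Type) (h : T -> U) (f : qform T) : qform U :=
  match f with
  | Atom r t1 t2 => Atom r (h t1) (h t2)
  | Top => Top
  | Bot => Bot
  | Neg f1 => Neg (qmap h f1)
  | And fs => And (map (qmap h) fs)
  | Or fs => Or (map (qmap h) fs)
  | Imp f1 f2 => Imp (qmap h f1) (qmap h f2)
  | Iff f1 f2 => Iff (qmap h f1) (qmap h f2)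
  end.

Fixpoint qvars (V T : Type) (tv : T -> seq V) (f : qform T) : seq V :=
  match f with
  | Atom _ t1 t2 => tv t1 ++ tv t2
  | Top | Bot => [::]
  | Neg f1 => qvars tv f1
  | And fs | Or fs => flatten (map (qvars tv) fs)
  | Imp f1 f2 | Iff f1 f2 => qvars tv f1 ++ qvars tv f2
  end.

Definition free_vars (V : eqType) (T : Type) (tv : T -> seq V)
    (phi : prenex V T) : seq V :=
  [seq v <- qvars tv (body phi) | v \notin unzip2 (quants phi)].

Fixpoint qholds (T : Type) (I : relsym -> T -> T -> bool) (f : qform T) : bool :=
  match f with
  | Atom r t1 t2 => I r t1 t2
  | Top => true
  | Bot => false
  | Neg f1 => ~~ qholds I f1
  | And fs => all (qholds I) fs
  | Or fs => has (qholds I) fs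
  | Imp f1 f2 => qholds I f1 ==> qholds I f2
  | Iff f1 f2 => qholds I f1 == qholds I f2
  end.

Fixpoint pholds (V : eqType) (D : Type) (pre : seq (quantifier * V))
    (M : (V -> D) -> Prop) (e : V -> D) : Prop :=
  match pre with
  | [::] => M e
  | (Ex, v) :: pre' => exists x : D, pholds pre' M [eta e with v |-> x]
  | (All, v) :: pre' => forall x : D, pholds pre' M [eta e with v |-> x]
  end.

Definition dual (q : quantifier) : quantifier :=
  match q with Ex => All | All => Ex end.

Definition pneg (V T : Type) (phi : prenex V T) : prenex V T :=
  Prenex [seq (dual qv.1, qv.2) | qv <- quants phi] (Neg (body phi)).

(** ** The language of complex numbers *)

Definition qconst := {q : rat | 0 <= q}.

Definition qconst0 : qconst := Sub 0 (lexx 0).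

Inductive cterm :=
| CVar (z : nat)
| CConst (q : qconst)
| CI
| CAdd (s t : cterm)
| CMul (s t : cterm)
| COpp (t : cterm)
| CRe (t : cterm)
| CIm (t : cterm)
| CConj (t : cterm).

Definition cqform := qform cterm.
Definition cformula := prenex nat cterm.

Fixpoint cvars (t : cterm) : seq nat :=
  match t with
  | CVar z => [:: z]
  | CConst _ | CI => [::]
  | CAdd s t | CMul s t => cvars s ++ cvars t
  | COpp t | CRe t | CIm t | CConj t => cvars t
  end.

(* Stated over K[i] for any real field K, since ground formulas are also
   evaluated in the Gaussian rationals rat[i]. *)
Fixpoint ceval (K : realFieldType) (e : nat -> K[i]) (t : cterm) : K[i] :=
  match t with
  | CVar z => e z
  | CConst q => (ratr (val q))%:C%C
  | CI => 'i%C
  | CAdd s t => ceval e s + ceval e t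
  | CMul s t => ceval e s * ceval e t
  | COpp t => - ceval e t
  | CRe t => (complex.Re (ceval e t))%:C%C
  | CIm t => (complex.Im (ceval e t))%:C%C
  | CConj t => conjc (ceval e t)
  end.

(* [Le] and [Lt] are only ever used on real values, where comparing real parts
   is the usual order. *)
Definition crel (K : realFieldType) (r : relsym) (x y : K[i]) : bool :=
  match r with
  | Eq => x == y
  | Ne => x != y
  | Le => complex.Re x <= complex.Re y
  | Lt => complex.Re x < complex.Re y
  end.

Definition cqholds (K : realFieldType) (e : nat -> K[i]) (f : cqform) : bool :=
  qholds (fun r s t => crel r (ceval e s) (ceval e t)) f.

Definition cholds (R : realType) (e : nat -> R[i]) (phi : cformula) : Prop :=
  pholds (quants phi) (fun e' => cqholds e' (body phi)) e.

Definition real_term (R : realType) (t : cterm) : Prop :=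
  forall e : nat -> R[i], complex.Im (ceval e t) = 0.

Definition cwf_atom (R : realType) (r : relsym) (s t : cterm) : Prop :=
  match r with
  | Eq | Ne => True
  | Le | Lt => real_term R s /\ real_term R t
  end.

(* [cterm] and [qform] do not enforce that order atoms compare real terms, so
   prenex first-order formulas are the [phi : cformula] with [cwf R phi]. *)
Definition cwf (R : realType) (phi : cformula) : Prop :=
  qall (cwf_atom R) (body phi).

Definition sentence (R : realType) (phi : cformula) : Prop :=
  cwf R phi /\ free_vars cvars phi = [::].

Definition Theta (R : realType) (phi : cformula) : Prop :=
  sentence R phi /\ forall e : nat -> R[i], cholds e phi.

Definition complete (R : realType) (S : cformula -> Prop) : Prop :=
  forall phi, sentence R phi -> S phi \/ S (pneg phi).

(** ** The language of ordered rings with rational constants *)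

(* The auxiliary variables z^Re and z^Im are [(z, false)] and [(z, true)]. *)
Definition rvar := (nat * bool)%type.

Inductive rterm :=
| RVar (x : rvar)
| RConst (q : qconst)
| RAdd (s t : rterm)
| RMul (s t : rterm)
| ROpp (t : rterm).

Definition rqform := qform rterm.
Definition rformula := prenex rvar rterm.

Fixpoint rvars (t : rterm) : seq rvar :=
  match t with
  | RVar x => [:: x]
  | RConst _ => [::]
  | RAdd s t | RMul s t => rvars s ++ rvars t
  | ROpp t => rvars t
  end.

Fixpoint reval (R : realType) (e : rvar -> R) (t : rterm) : R :=
  match t with
  | RVar x => e x
  | RConst q => ratr (val q)
  | RAdd s t => reval e s + reval e t
  | RMul s t => reval e s * reval e t
  | ROpp t => - reval e t
  end.

Definition rrel (R : realType) (r : relsym) (x y : R) : bool :=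
  match r with
  | Eq => x == y
  | Ne => x != y
  | Le => x <= y
  | Lt => x < y
  end.

Definition rqholds (R : realType) (e : rvar -> R) (f : rqform) : bool :=
  qholds (fun r s t => rrel r (reval e s) (reval e t)) f.

Definition rholds (R : realType) (e : rvar -> R) (psi : rformula) : Prop :=
  pholds (quants psi) (fun e' => rqholds e' (body psi)) e.

(** ** Algorithms *)

(* The total recursive functions: closure of zero, successor and projections
   under composition, primitive recursion and regular minimization. The
   schemes are given by their defining equations. *)
Inductive recursive : forall n, (n.-tuple nat -> nat) -> Prop :=
| rec_zero n : recursive (fun _ : n.-tuple nat => 0%N)
| rec_succ : recursive (fun v : 1.-tuple nat => (thead v).+1)
| rec_proj n (i : 'I_n) : recursive (fun v : n.-tuple nat => tnth v i)
| rec_comp m n (g : m.-tuple nat -> nat) (h : 'I_m -> n.-tuple nat -> nat) :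
    recursive g -> (forall i, recursive (h i)) ->
    recursive (fun v => g [tuple h i v | i < m])
| rec_prim n (g : n.-tuple nat -> nat) (h : n.+2.-tuple nat -> nat)
    (f : n.+1.-tuple nat -> nat) :
    recursive g -> recursive h ->
    (forall v : n.-tuple nat, f (cons_tuple 0%N v) = g v) ->
    (forall k (v : n.-tuple nat), f (cons_tuple k.+1 v)
       = h (cons_tuple k (cons_tuple (f (cons_tuple k v)) v))) ->
    recursive f
| rec_min n (g : n.+1.-tuple nat -> nat) (f : n.-tuple nat -> nat) :
    recursive g ->
    (forall v : n.-tuple nat, g (cons_tuple (f v) v) = 0%N) ->
    (forall (v : n.-tuple nat) k, (k < f v)%N -> g (cons_tuple k v) <> 0%N) ->
    recursive f.

(* Goedel numberings, on top of the bijection [CodeSeq.code : seq nat -> nat];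
   each node is coded as a tag followed by the codes of its children. *)
Definition code_relsym (r : relsym) : nat :=
  match r with Eq => 0 | Ne => 1 | Le => 2 | Lt => 3 end.

Definition code_quantifier (q : quantifier) : nat :=
  match q with Ex => 0 | All => 1 end.

Definition code_qconst (q : qconst) : nat :=
  CodeSeq.code [:: `|numq (val q)|%N; `|denq (val q)|%N].

Fixpoint code_cterm (t : cterm) : nat :=
  match t with
  | CVar z => CodeSeq.code [:: 0; z]
  | CConst q => CodeSeq.code [:: 1; code_qconst q]
  | CI => CodeSeq.code [:: 2]
  | CAdd s t => CodeSeq.code [:: 3; code_cterm s; code_cterm t]
  | CMul s t => CodeSeq.code [:: 4; code_cterm s; code_cterm t]
  | COpp t => CodeSeq.code [:: 5; code_cterm t]
  | CRe t => CodeSeq.code [:: 6; code_cterm t]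
  | CIm t => CodeSeq.code [:: 7; code_cterm t]
  | CConj t => CodeSeq.code [:: 8; code_cterm t]
  end%N.

Definition code_rvar (x : rvar) : nat := CodeSeq.code [:: x.1; nat_of_bool x.2].

Fixpoint code_rterm (t : rterm) : nat :=
  match t with
  | RVar x => CodeSeq.code [:: 0; code_rvar x]
  | RConst q => CodeSeq.code [:: 1; code_qconst q]
  | RAdd s t => CodeSeq.code [:: 2; code_rterm s; code_rterm t]
  | RMul s t => CodeSeq.code [:: 3; code_rterm s; code_rterm t]
  | ROpp t => CodeSeq.code [:: 4; code_rterm t]
  end%N.

Fixpoint code_qform (T : Type) (ct : T -> nat) (f : qform T) : nat :=
  match f with
  | Atom r s t => CodeSeq.code [:: 0; code_relsym r; ct s; ct t]
  | Top => CodeSeq.code [:: 1]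
  | Bot => CodeSeq.code [:: 2]
  | Neg f1 => CodeSeq.code [:: 3; code_qform ct f1]
  | And fs => CodeSeq.code (4 :: map (code_qform ct) fs)
  | Or fs => CodeSeq.code (5 :: map (code_qform ct) fs)
  | Imp f1 f2 => CodeSeq.code [:: 6; code_qform ct f1; code_qform ct f2]
  | Iff f1 f2 => CodeSeq.code [:: 7; code_qform ct f1; code_qform ct f2]
  end%N.

Definition code_prenex (V T : Type) (cv : V -> nat) (ct : T -> nat)
    (phi : prenex V T) : nat :=
  CodeSeq.code
    [:: CodeSeq.code [seq CodeSeq.code [:: code_quantifier qv.1; cv qv.2]
                     | qv <- quants phi];
        code_qform ct (body phi)].

Definition code_cformula : cformula -> nat := code_prenex id code_cterm.
Definition code_rformula : rformula -> nat := code_prenex code_rvar code_rterm.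
Definition code_rqform : rqform -> nat := code_qform code_rterm.

(* [F] is computed on codes by an algorithm, for inputs in the domain [D]. *)
Definition computable_on (A B : Type) (cA : A -> nat) (cB : B -> nat)
    (D : A -> Prop) (F : A -> B) : Prop :=
  exists2 f : 1.-tuple nat -> nat, recursive f &
    forall a, D a -> f [tuple cA a] = cB (F a).

Definition decision_procedure (R : realType) (S : cformula -> Prop)
    (d : cformula -> bool) : Prop :=
  computable_on code_cformula nat_of_bool (sentence R) d /\
  forall phi, sentence R phi -> (d phi <-> S phi).

Definition decidable_theory (R : realType) (S : cformula -> Prop) : Prop :=
  exists d : cformula -> bool, decision_procedure R S d.

(** ** Pseudo-complex quantifier elimination *)

Fixpoint rnf_term (t : cterm) : bool :=
  match t with
  | CRe (CVar _) | CIm (CVar _) | CConst _ => true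
  | CAdd s t | CMul s t => rnf_term s && rnf_term t
  | COpp t => rnf_term t
  | _ => false
  end.

Definition real_normal_form (phi : cformula) : Prop :=
  qall (fun _ s t => rnf_term s /\ t = CConst qconst0) (body phi).

Definition rnf_procedure (R : realType) (rnf : cformula -> cformula) : Prop :=
  computable_on code_cformula code_cformula (cwf R) rnf /\
  forall phi, cwf R phi ->
    [/\ real_normal_form (rnf phi),
        {subset free_vars cvars (rnf phi) <= free_vars cvars phi} &
        forall e : nat -> R[i], cholds e phi <-> cholds e (rnf phi)].

(* Only applied to terms satisfying [rnf_term]; the value on other
   terms is irrelevant. *)
Fixpoint split_term (t : cterm) : rterm :=
  match t with
  | CRe (CVar z) => RVar (z, false)
  | CIm (CVar z) => RVar (z, true)
  | CConst q => RConst q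
  | CAdd s t => RAdd (split_term s) (split_term t)
  | CMul s t => RMul (split_term s) (split_term t)
  | COpp t => ROpp (split_term t)
  | _ => RConst qconst0
  end.

Definition split_formula (phi : cformula) : rformula :=
  Prenex (flatten [seq [:: (qv.1, (qv.2, false)); (qv.1, (qv.2, true))]
                  | qv <- quants phi])
         (qmap split_term (body phi)).

Definition real_qe_procedure (R : realType) (rqe : rformula -> rqform) : Prop :=
  computable_on code_rformula code_rqform (fun _ => True) rqe /\
  forall psi,
    {subset qvars rvars (rqe psi) <= free_vars rvars psi} /\
    forall e : rvar -> R, rholds e psi <-> rqholds e (rqe psi).

Fixpoint join_term (t : rterm) : cterm :=
  match t with
  | RVar (z, im) => if im then CIm (CVar z) else CRe (CVar z)
  | RConst q => CConst q
  | RAdd s t => CAdd (join_term s) (join_term t)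
  | RMul s t => CMul (join_term s) (join_term t)
  | ROpp t => COpp (join_term t)
  end.

Definition pseudo_complex_qe (rnf : cformula -> cformula)
    (rqe : rformula -> rqform) (phi : cformula) : cqform :=
  qmap join_term (rqe (split_formula (rnf phi))).

(* Truth of a variable-free formula, computed in the Gaussian rationals. *)
Definition ground_eval (f : cqform) : bool := cqholds (fun=> 0 : rat[i]) f.

(* Main.v *)
Require Import Defs.
From HB Require Import structures.
From mathcomp Require Import all_boot all_order all_algebra.
From mathcomp Require Import reals complex polyorder polyrcf.
From mathcomp Require boolp.
From mathcomp Require Import zify ring.

(* A sentence is first rewritten in terms of the real and imaginary parts of its
   variables, and each complex quantifier becomes two real ones, so everything
   reduces to a computable quantifier elimination over the reals.

   To eliminate one real variable x from a quantifier-free formula, view its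
   atoms as formal polynomials in x, whose leading coefficients may vanish, and
   close this finite set under dropping the leading term, differentiation and
   pseudo-remainders (Hormander's method).  The signs of all coefficients then
   determine the sign table of the whole set along the real line.  Polynomials
   are inserted by increasing formal degree: at a root of an earlier g, the sign
   of f is that of the remainder of f by g; between consecutive roots f is
   strictly monotone, as the sign of its derivative is already known to be
   constant there, so f acquires a new root exactly when its signs at the ends
   are opposite.  The output is the disjunction, over all sign assignments to the
   coefficients whose table satisfies the formula in some column, of the
   conditions describing the assignment.

   Computability is proved compositionally: [Comp F] says that F is recursive on
   codes, and the combinators used to write the algorithm (primitive recursion,
   list functions, folds over terms and formulas) preserve it.  All recursions on
   syntax reduce to course-of-values recursion on codes.

   A variable-free formula has the same truth value in the Gaussian rationals as
   in the complex numbers, and it is decided by arithmetic on natural numbers. *)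

Set Implicit Arguments.
Unset Strict Implicit.
Unset Printing Implicit Defensive.
Local Arguments CodeSeq.code : simpl never.

Import Order.TTheory GRing.Theory Num.Theory.

(** * Recursive functions *)

(** Functions are written on plain lists, so that arities stay out of their types; only the values
    on lists of length [n] matter. *)
Definition recn n (F : seq nat -> nat) := recursive (fun v : n.-tuple nat => F v).
Definition rec1 (f : nat -> nat) := recn 1 (fun s => f (nth 0 s 0)).
Definition rec2 (f : nat -> nat -> nat) :=
  recn 2 (fun s => f (nth 0 s 0) (nth 0 s 1)).
Definition rec3 (f : nat -> nat -> nat -> nat) :=
  recn 3 (fun s => f (nth 0 s 0) (nth 0 s 1) (nth 0 s 2)).

Lemma eq_recursive n (f g : n.-tuple nat -> nat) :
  f =1 g -> recursive f -> recursive g.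
Proof. by move=> /boolp.funext ->. Qed.

Lemma recn_nth n i : recn n (fun s => nth 0 s i).
Proof.
have [lt_in|le_ni] := ltnP i n.
  apply: eq_recursive (rec_proj (Ordinal lt_in)) => v.
  by rewrite (tnth_nth 0).
apply: eq_recursive (rec_zero n) => v.
by rewrite nth_default ?size_tuple.
Qed.

Lemma recn_comp m n (G : seq nat -> nat) (hs : seq (seq nat -> nat)) :
    size hs = m -> recn m G ->
    foldr (fun h Q => recn n h /\ Q) True hs ->
  recn n (fun s => G [seq h s | h <- hs]).
Proof.
move=> szhs recG rec_hs.
have rech i : (i < size hs)%N -> recn n (nth (fun=> 0) hs i).
  elim: hs {szhs} rec_hs i => //= h hs IHhs [rech rec_hs] [|i] //.
  exact: IHhs.
have := @rec_comp m n (fun v => G v)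
  (fun i v => nth (fun=> 0) hs i v) recG.
have -> : (forall i : 'I_m, recursive (fun v : n.-tuple nat =>
    nth (fun=> 0) hs i v)) <-> True.
  by split=> // _ i; apply: rech; rewrite szhs.
move=> /(_ I); apply: eq_recursive => v.
congr G; apply: (@eq_from_nth _ 0) => [|i].
  by rewrite size_tuple size_map.
rewrite size_tuple => lt_im.
rewrite (nth_mktuple _ _ (Ordinal lt_im)) /=.
by rewrite (nth_map (fun=> 0)) ?szhs.
Qed.

Lemma recn_app1 n f a : rec1 f -> recn n a -> recn n (fun s => f (a s)).
Proof. by move=> rf ra; apply: (@recn_comp _ n _ [:: a] _ rf). Qed.

Lemma recn_app2 n f a b :
  rec2 f -> recn n a -> recn n b -> recn n (fun s => f (a s) (b s)).
Proof. by move=> rf ra rb; apply: (@recn_comp _ n _ [:: a; b] _ rf). Qed.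

Lemma recn_cst n k : recn n (fun=> k).
Proof.
elim: k => [|k IHk]; first exact: rec_zero.
apply: (@recn_app1 n succn) => //; apply: eq_recursive rec_succ => v.
by case/tupleP: v => x v; rewrite theadE.
Qed.

Lemma rec1_cst k : rec1 (fun=> k).
Proof. exact: recn_cst. Qed.

Lemma rec1_succ : rec1 succn.
Proof.
apply: eq_recursive rec_succ => v; by case/tupleP: v => x v; rewrite theadE.
Qed.

Lemma rec2_iteri b h : rec1 b -> rec3 h ->
  rec2 (fun k x => iteri k (fun i r => h i r x) (b x)).
Proof. by move=> rb rh; apply: rec_prim rb rh _ _ => // v; rewrite /= theadE. Qed.

Lemma recn_min n (G F : seq nat -> nat) : recn n.+1 G ->
    (forall v, G (F v :: v) = 0) ->
    (forall v k, k < F v -> G (k :: v) <> 0) ->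
  recn n F.
Proof. by move=> rG G0 Gn0; apply: rec_min rG _ _ => v //= k; apply: Gn0. Qed.

Lemma rec2_swap f : rec2 f -> rec2 (fun x y => f y x).
Proof. by move=> rf; apply: recn_app2 rf (recn_nth _ _) (recn_nth _ _). Qed.

Lemma rec1_comp2 f a b : rec2 f -> rec1 a -> rec1 b -> rec1 (fun x => f (a x) (b x)).
Proof. exact: recn_app2. Qed.

(** * Recursiveness of elementary arithmetic and of list codes *)

Lemma rec2_add : rec2 addn.
Proof.
suff -> : addn = fun k x => iteri k (fun i r => r.+1) x.
  apply: (@rec2_iteri id (fun i r x => r.+1)); first exact: recn_nth.
  exact: recn_app1 rec1_succ (recn_nth 3 1).
by apply/boolp.funext => k; apply/boolp.funext => x; elim: k => //= k <-.
Qed.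

Lemma rec2_mul : rec2 muln.
Proof.
suff -> : muln = fun k x => iteri k (fun i r => r + x) 0.
  apply: (@rec2_iteri (fun=> 0) (fun i r x => r + x)); first exact: recn_cst.
  exact: recn_app2 rec2_add (recn_nth 3 1) (recn_nth 3 2).
by apply/boolp.funext => k; apply/boolp.funext => x; elim: k => //= k <-; rewrite mulSnr.
Qed.

Lemma rec1_pred : rec1 predn.
Proof.
suff -> : predn = fun k => iteri k (fun i r => i) 0.
  have /recn_app2 := @rec2_iteri (fun=> 0) (fun i r x => i) (recn_cst 1 0) (recn_nth 3 0).
  by move=> /(_ 1 _ _ (recn_nth 1 0) (recn_nth 1 0)).
by apply/boolp.funext; case.
Qed.

Lemma rec2_sub : rec2 subn.
Proof.
apply/rec2_swap.
suff -> : (fun x y => y - x) = fun k x => iteri k (fun i r => r.-1) x.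
  apply: (@rec2_iteri id (fun i r x => r.-1)); first exact: recn_nth.
  exact: recn_app1 rec1_pred (recn_nth 3 1).
apply/boolp.funext => k; apply/boolp.funext => x.
by elim: k => [|k /= <-]; rewrite ?subn0 ?subnS.
Qed.

Lemma rec1_exp2 : rec1 (expn 2).
Proof.
suff -> : expn 2 = fun k => iteri k (fun i r => r + r) 1.
  have /recn_app2 := @rec2_iteri (fun=> 1) (fun i r x => r + r) (recn_cst 1 1)
    (recn_app2 rec2_add (recn_nth 3 1) (recn_nth 3 1)).
  by move=> /(_ 1 _ _ (recn_nth 1 0) (recn_nth 1 0)).
by apply/boolp.funext; elim=> //= k <-; rewrite expnS mul2n addnn.
Qed.

(** For [d > 0] the quotient [m %/ d] is the least [k] with [m < k.+1 * d]. The outer factor [d] of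
    the minimized function makes the search stop at 0 when [d] is 0, in agreement with
    [m %/ 0 = 0]. *)
Lemma rec2_div : rec2 divn.
Proof.
apply: (@recn_min 2 (fun s => nth 0 s 2 * ((nth 0 s 1).+1 - (nth 0 s 0).+1 * nth 0 s 2))).
- apply: recn_app2 rec2_mul (recn_nth 3 2) _.
  apply: recn_app2 rec2_sub _ _; first exact: recn_app1 rec1_succ (recn_nth _ _).
  apply: recn_app2 rec2_mul _ (recn_nth _ _).
  exact: recn_app1 rec1_succ (recn_nth _ _).
- move=> v /=; move: (nth 0 v 0) (nth 0 v 1) => m [|d] //.
  by apply/eqP; rewrite muln_eq0 subn_eq0 orbC ltn_ceil.
- move=> v k /=; move: (nth 0 v 0) (nth 0 v 1) => m [|d] //.
  rewrite leq_divRL // => le_kd /eqP; rewrite muln_eq0 subn_eq0 /=.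
  by rewrite ltnNge le_kd.
Qed.

(** The pairing underlying [CodeSeq.code]: every positive number is uniquely of the form
    [2 ^ a * (2 * b + 1)], and 0 is left for the empty list. *)
Definition ccons a b := 2 ^ a * b.*2.+1.
Definition chead n := head 0 (CodeSeq.decode n).
Definition ctail n := CodeSeq.code (behead (CodeSeq.decode n)).

Lemma code_cons a s : CodeSeq.code (a :: s) = ccons a (CodeSeq.code s).
Proof. by []. Qed.

Lemma chead_cons a b : chead (ccons a b) = a.
Proof. by rewrite -(CodeSeq.decodeK b) -code_cons /chead CodeSeq.codeK. Qed.

Lemma ctail_cons a b : ctail (ccons a b) = b.
Proof. by rewrite -{1}(CodeSeq.decodeK b) -code_cons /ctail CodeSeq.codeK /= CodeSeq.decodeK. Qed.

Variant ccons_spec : nat -> Prop :=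
| CconsNil : ccons_spec 0
| CconsCons a b : ccons_spec (ccons a b).

Lemma cconsP n : ccons_spec n.
Proof.
rewrite -(CodeSeq.decodeK n); case: CodeSeq.decode => [|a s]; first exact: CconsNil.
rewrite code_cons; exact: CconsCons.
Qed.

Lemma ccons_eq0 a b : (ccons a b == 0) = false.
Proof. by apply: negbTE; rewrite -lt0n muln_gt0 expn_gt0. Qed.

Lemma rec2_ccons : rec2 ccons.
Proof.
apply: recn_app2 rec2_mul _ _; first exact: recn_app1 rec1_exp2 (recn_nth _ _).
apply: recn_app1 rec1_succ _.
suff -> : (fun s => (nth 0 s 1).*2) = fun s => nth 0 s 1 + nth 0 s 1.
  exact: recn_app2 rec2_add (recn_nth _ _) (recn_nth _ _).
by apply/boolp.funext => s; rewrite addnn.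
Qed.

Lemma rec2_mod : rec2 modn.
Proof.
suff -> : modn = fun m d => m - m %/ d * d.
  apply: recn_app2 rec2_sub (recn_nth _ _) _.
  exact: recn_app2 rec2_mul rec2_div (recn_nth _ _).
apply/boolp.funext => m; apply/boolp.funext => d.
by rewrite {2}(divn_eq m d) addnC addnK.
Qed.

(** The head of a nonzero code [n] is its 2-adic valuation, the least [k] such that [2 ^ k.+1] does
    not divide [n]. The outer factor [n] stops the search at 0 on the code of the empty list. *)
Lemma rec1_chead : rec1 chead.
Proof.
apply: (@recn_min 1 (fun s => nth 0 s 1 * (1 - nth 0 s 1 %% 2 ^ (nth 0 s 0).+1))).
- apply: recn_app2 rec2_mul (recn_nth 2 1) _.
  apply: recn_app2 rec2_sub (recn_cst _ _) _.
  apply: recn_app2 rec2_mod (recn_nth 2 1) _.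
  exact: recn_app1 rec1_exp2 (recn_app1 rec1_succ (recn_nth _ _)).
- move=> v /=; case: (cconsP (nth 0 v 0)) => // a b; rewrite chead_cons.
  apply/eqP; rewrite muln_eq0 ccons_eq0 subn_eq0 lt0n -/(dvdn _ _).
  rewrite expnSr dvdn_pmul2l ?expn_gt0 //.
  by rewrite dvdn2 /= odd_double.
- move=> v k /=; case: (cconsP (nth 0 v 0)) => // a b; rewrite chead_cons => lt_ka.
  have /eqP -> : 2 ^ k.+1 %| ccons a b by rewrite dvdn_mulr // dvdn_exp2l.
  by rewrite muln1 => /eqP; rewrite ccons_eq0.
Qed.

Lemma rec1_ctail : rec1 ctail.
Proof.
suff -> : ctail = fun n => n %/ 2 ^ chead n %/ 2.
  apply: recn_app2 rec2_div _ (recn_cst _ _).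
  apply: recn_app2 rec2_div (recn_nth _ _) _.
  exact: recn_app1 rec1_exp2 (recn_app1 rec1_chead (recn_nth _ _)).
apply/boolp.funext => n; case: (cconsP n) => // a b.
rewrite ctail_cons chead_cons mulKn ?expn_gt0 //.
by rewrite divn2 /= uphalf_double.
Qed.

(** * Computability on codes *)

Class Enc (A : Type) := enc : A -> nat.
Instance enc_nat : Enc nat := id.
Instance enc_bool : Enc bool := nat_of_bool.
Instance enc_seq A {EA : Enc A} : Enc (seq A) :=
  fun s => CodeSeq.code (map enc s).
Instance enc_prod A B {EA : Enc A} {EB : Enc B} : Enc (A * B) :=
  fun p => CodeSeq.code [:: enc p.1; enc p.2].

(** The realizer is constrained only on codes; functions of several arguments are treated as
    functions of tuples. *)
Definition Comp {A B} {EA : Enc A} {EB : Enc B} (F : A -> B) :=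
  exists2 f, rec1 f & forall a, f (enc a) = enc (F a).

Lemma chead_code a s : chead (CodeSeq.code (a :: s)) = a.
Proof. exact: chead_cons. Qed.

Lemma ctail_code a s : ctail (CodeSeq.code (a :: s)) = CodeSeq.code s.
Proof. exact: ctail_cons. Qed.

Definition codeE := (chead_code, ctail_code).

Lemma code_eq0 s : (CodeSeq.code s == 0) = nilp s.
Proof. by case: s => // a s; rewrite code_cons ccons_eq0. Qed.

Section Basic.
Context {X A B D : Type} {EX : Enc X} {EA : Enc A} {EB : Enc B} {ED : Enc D}.

Lemma comp_cst (a : A) : Comp (fun _ : X => a).
Proof. by exists (fun=> enc a) => //; apply: recn_cst. Qed.

Lemma comp_id : Comp (fun x : X => x).
Proof. by exists id => //; apply: recn_nth. Qed.

Lemma comp_comp (F : A -> B) (a : X -> A) : Comp F -> Comp a -> Comp (fun x => F (a x)).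
Proof.
move=> [f rf fE] [g rg gE]; exists (fun n => f (g n)); first exact: (recn_app1 rf rg).
by move=> x; rewrite gE fE.
Qed.

Lemma comp_rec1 (f : nat -> nat) (F : A -> B) (a : X -> A) :
  rec1 f -> (forall x, f (enc x) = enc (F x)) -> Comp a -> Comp (fun x => F (a x)).
Proof. by move=> rf fE; apply: comp_comp; exists f. Qed.

Lemma comp_rec2 (f : nat -> nat -> nat) (F : A -> B -> D) (a : X -> A) (b : X -> B) :
    rec2 f -> (forall x y, f (enc x) (enc y) = enc (F x y)) ->
  Comp a -> Comp b -> Comp (fun x => F (a x) (b x)).
Proof.
move=> rf fE [g rg gE] [h rh hE]; exists (fun n => f (g n) (h n)).
  exact: (rec1_comp2 rf rg rh).
by move=> x; rewrite gE hE fE.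
Qed.

End Basic.

Lemma rec2_pair : rec2 (fun a b => ccons a (ccons b 0)).
Proof.
apply: recn_app2 rec2_ccons (recn_nth _ _) _.
exact: recn_app2 rec2_ccons (recn_nth _ _) (recn_cst _ _).
Qed.

Section Structures.
Context {X A B : Type} {EX : Enc X} {EA : Enc A} {EB : Enc B}.

Lemma comp_pair (a : X -> A) (b : X -> B) :
  Comp a -> Comp b -> Comp (fun x => (a x, b x)).
Proof. exact: comp_rec2 rec2_pair _. Qed.

Lemma comp_fst (a : X -> A * B) : Comp a -> Comp (fun x => (a x).1).
Proof. by apply: comp_rec1 rec1_chead _ => p; rewrite {1}/enc /enc_prod codeE. Qed.

Lemma comp_snd (a : X -> A * B) : Comp a -> Comp (fun x => (a x).2).
Proof.
have rs : rec1 (fun n => chead (ctail n)) := recn_app1 rec1_chead rec1_ctail.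
apply: (comp_rec1 rs) => p.
by rewrite {1}/enc /enc_prod !codeE.
Qed.

(** Truth values are coded by 0 and 1, so the choice is the arithmetic expression
    [c * a + (1 - c) * b]. *)
Lemma comp_if (c : X -> bool) (a b : X -> A) :
  Comp c -> Comp a -> Comp b -> Comp (fun x => if c x then a x else b x).
Proof.
move=> [h rh hE] [f rf fE] [g rg gE].
exists (fun n => h n * f n + (1 - h n) * g n).
  apply: rec1_comp2 rec2_add _ _; apply: rec1_comp2 rec2_mul _ _ => //.
  exact: (@rec1_comp2 _ (fun=> 1) h rec2_sub (recn_cst _ _) rh).
by move=> x; rewrite hE fE gE; case: (c x); rewrite /enc/= ?mul1n ?mul0n ?addn0.
Qed.

Lemma comp_cons (a : X -> A) (s : X -> seq A) :
  Comp a -> Comp s -> Comp (fun x => a x :: s x).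
Proof. exact: comp_rec2 rec2_ccons _. Qed.

Lemma comp_behead (s : X -> seq A) : Comp s -> Comp (fun x => behead (s x)).
Proof. by apply: comp_rec1 rec1_ctail _ => -[|a t] //=; rewrite /enc/= /enc_seq/= codeE. Qed.

Lemma comp_head d (s : X -> seq A) : Comp s -> Comp (fun x => head d (s x)).
Proof.
(* [1 - n] is 1 exactly on the code 0 of the empty list, where it selects the default [d]. *)
have rh : rec1 (fun n => (1 - n) * enc d + (1 - (1 - n)) * chead n).
  have r1 : rec1 (subn 1) := recn_app2 rec2_sub (recn_cst _ _) (recn_nth _ _).
  apply: (rec1_comp2 rec2_add).
    exact: (rec1_comp2 rec2_mul r1 (rec1_cst _)).
  by apply: (rec1_comp2 rec2_mul _ rec1_chead); apply: (recn_app1 r1 r1).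
apply: comp_rec1 rh _ => -[|a t]; rewrite /enc /= /enc_seq /=.
  by rewrite /CodeSeq.code /= mul1n mul0n addn0.
rewrite codeE (_ : 1 - _ = 0) ?mul1n //; apply/eqP.
by rewrite subn_eq0 lt0n code_eq0.
Qed.

End Structures.

Lemma comp_realizer {X} {EX : Enc X} (f : nat -> nat) (a : X -> nat) :
  rec1 f -> Comp a -> Comp (fun x => f (a x)).
Proof. by move=> rf; apply: comp_rec1 rf _. Qed.

(* [comp] proves [Comp (fun x => E)] by committed steps on the shape of [E];
   [comp_ext] is redefined whenever new closure lemmas become available. *)
Ltac comp_ext := fail.
Ltac comp_hyp :=
  match goal with
  | H : Comp ?f |- Comp (fun y => ?f (@?a y)) =>
      apply (comp_comp (a := a) H)
  | H : Comp (fun p => ?f p.1 p.2) |- Comp (fun y => ?f (@?a y) (@?b y)) =>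
      apply (comp_comp (a := fun y => (a y, b y)) H)
  | H : Comp (fun p => ?f p.1 p.2.1 p.2.2) |-
      Comp (fun y => ?f (@?a y) (@?b y) (@?c y)) =>
      apply (comp_comp (a := fun y => (a y, (b y, c y))) H)
  | H : rec1 ?f |- Comp (fun y => ?f (@?a y)) =>
      apply (comp_realizer (a := a) H)
  end.
Ltac comp_step :=
  first [ assumption | simple apply comp_cst | simple apply comp_id
        | simple apply comp_pair | simple apply comp_fst | simple apply comp_snd
        | simple apply comp_cons | simple apply comp_if | simple apply comp_behead
        | simple apply comp_head | comp_hyp | comp_ext ].
Ltac comp := solve [repeat comp_step].

Section Nat.
Context {X : Type} {EX : Enc X}.
Implicit Types a b : X -> nat.

Lemma comp_succ a : Comp a -> Comp (fun x => (a x).+1).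
Proof. exact: comp_rec1 rec1_succ _. Qed.
Lemma comp_predn a : Comp a -> Comp (fun x => (a x).-1).
Proof. exact: comp_rec1 rec1_pred _. Qed.
Lemma comp_addn a b : Comp a -> Comp b -> Comp (fun x => a x + b x).
Proof. exact: comp_rec2 rec2_add _. Qed.
Lemma comp_subn a b : Comp a -> Comp b -> Comp (fun x => a x - b x).
Proof. exact: comp_rec2 rec2_sub _. Qed.
Lemma comp_muln a b : Comp a -> Comp b -> Comp (fun x => a x * b x).
Proof. exact: comp_rec2 rec2_mul _. Qed.
Lemma comp_leq a b : Comp a -> Comp b -> Comp (fun x => a x <= b x).
Proof.
apply: (@comp_rec2 _ _ _ _ _ _ _ _ (fun m n => 1 - (m - n))).
  exact: recn_app2 rec2_sub (recn_cst _ _) rec2_sub.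
by move=> m n; rewrite /enc/= /enc_nat /leq; case: (m - n).
Qed.
End Nat.

Ltac comp_nat :=
  first [ simple apply comp_succ | simple apply comp_predn | simple apply comp_addn
        | simple apply comp_subn | simple apply comp_muln | simple apply comp_leq ].
Ltac comp_ext ::= comp_nat.

Section Bool.
Context {X : Type} {EX : Enc X}.
Implicit Types a b : X -> bool.
Lemma comp_negb a : Comp a -> Comp (fun x => ~~ a x).
Proof. by move=> ca; apply: (@comp_if _ _ _ _ a (fun=> false) (fun=> true)); comp. Qed.
Lemma comp_andb a b : Comp a -> Comp b -> Comp (fun x => a x && b x).
Proof. by move=> ca cb; apply: (@comp_if _ _ _ _ a b (fun=> false)); comp. Qed.
Lemma comp_orb a b : Comp a -> Comp b -> Comp (fun x => a x || b x).
Proof. by move=> ca cb; apply: (@comp_if _ _ _ _ a (fun=> true) b); comp. Qed.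
Lemma comp_implb a b : Comp a -> Comp b -> Comp (fun x => a x ==> b x).
Proof. by move=> ca cb; apply: (@comp_if _ _ _ _ a b (fun=> true)); comp. Qed.
End Bool.

Ltac comp_bool :=
  first [ simple apply comp_negb | simple apply comp_andb | simple apply comp_orb
        | simple apply comp_implb ].
Ltac comp_ext ::= first [comp_nat | comp_bool].

Lemma comp_eqn {X} {EX : Enc X} (a b : X -> nat) :
  Comp a -> Comp b -> Comp (fun x => a x == b x).
Proof.
move=> ca cb; rewrite (_ : (fun x => a x == b x) = fun x => (a x <= b x) && (b x <= a x)).
  by comp.
by apply/boolp.funext => x; rewrite eqn_leq.
Qed.

Lemma comp_eqb {X} {EX : Enc X} (a b : X -> bool) :
  Comp a -> Comp b -> Comp (fun x => a x == b x).
Proof.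
move=> ca cb; rewrite (_ : (fun x => a x == b x) = fun x => if a x then b x else ~~ b x).
  by comp.
by apply/boolp.funext => x; case: (a x); case: (b x).
Qed.

Section Iteri.
Context {X A : Type} {EX : Enc X} {EA : Enc A}.

Lemma comp_iteri (h : X -> nat -> A -> A) (b : X -> A) (n : X -> nat) :
    Comp (fun p : X * (nat * A) => h p.1 p.2.1 p.2.2) -> Comp b -> Comp n ->
  Comp (fun x => iteri (n x) (h x) (b x)).
Proof.
move=> [f rf fE] [g rg gE] [k rk kE].
have rfp : rec3 (fun i r x => f (ccons x (ccons (ccons i (ccons r 0)) 0))).
  apply: recn_app1 rf _; apply: recn_app2 rec2_pair (recn_nth _ _) _.
  exact: recn_app2 rec2_pair (recn_nth _ _) (recn_nth _ _).
exists (fun x => iteri (k x) (fun i r => f (ccons x (ccons (ccons i (ccons r 0)) 0))) (g x)).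
  exact: (recn_app2 (rec2_iteri rg rfp) rk (recn_nth 1 0)).
move=> x; rewrite kE gE /enc/=; elim: (n x) => //= m ->.
exact: (fE (x, (m, _))).
Qed.

Lemma comp_iter (h : X -> A -> A) (b : X -> A) (n : X -> nat) :
    Comp (fun p : X * A => h p.1 p.2) -> Comp b -> Comp n ->
  Comp (fun x => iter (n x) (h x) (b x)).
Proof.
move=> ch cb cn.
suff -> : (fun x => iter (n x) (h x) (b x)) =
    fun x => iteri (n x) (fun _ => h x) (b x).
  apply: (comp_iteri (h := fun x _ => h x)) => //; comp.
by apply/boolp.funext => x; elim: (n x) => //= m ->.
Qed.
End Iteri.

Lemma comp_nth {X A} {EX : Enc X} {EA : Enc A} d (s : X -> seq A) (n : X -> nat) :
  Comp s -> Comp n -> Comp (fun x => nth d (s x) (n x)).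
Proof.
move=> cs cn.
suff -> : (fun x => nth d (s x) (n x)) = fun x => head d (iter (n x) behead (s x)).
  apply: comp_head; apply: (comp_iter (h := fun _ => behead)); comp.
apply/boolp.funext => x; elim: (n x) (s x) => [|m IHm] [|a t] //=.
  by rewrite -iterS iterSr /= -IHm nth_nil.
by rewrite -iterS iterSr /= -IHm.
Qed.

Ltac comp_eq := first [simple apply comp_eqn | simple apply comp_eqb].
Ltac comp_iters :=
  first [ simple apply comp_iteri | simple apply comp_iter | simple apply comp_nth ].
Ltac comp_ext ::= first [comp_nat | comp_bool | comp_eq | comp_iters].

Lemma comp_chead {X} {EX : Enc X} (a : X -> nat) : Comp a -> Comp (fun x => chead (a x)).
Proof. exact: comp_rec1 rec1_chead _. Qed.
Lemma comp_ctail {X} {EX : Enc X} (a : X -> nat) : Comp a -> Comp (fun x => ctail (a x)).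
Proof. exact: comp_rec1 rec1_ctail _. Qed.
Lemma comp_ccons {X} {EX : Enc X} (a b : X -> nat) :
  Comp a -> Comp b -> Comp (fun x => ccons (a x) (b x)).
Proof. exact: comp_rec2 rec2_ccons _. Qed.
Lemma enc_seq_nat (s : seq nat) : enc s = CodeSeq.code s.
Proof. by congr CodeSeq.code; elim: s => //= n s ->. Qed.

Lemma rec1_id : rec1 id.
Proof. exact: recn_nth. Qed.

(** A list of numbers and its code have the same encoding, so coding and decoding are both realized
    by the identity. *)
Lemma comp_code {X} {EX : Enc X} (a : X -> seq nat) :
  Comp a -> Comp (fun x => CodeSeq.code (a x)).
Proof. by apply: (comp_rec1 rec1_id) => s; rewrite enc_seq_nat. Qed.
Lemma comp_decode {X} {EX : Enc X} (a : X -> nat) :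
  Comp a -> Comp (fun x => CodeSeq.decode (a x)).
Proof.
by apply: (comp_rec1 rec1_id) => n; rewrite enc_seq_nat CodeSeq.decodeK.
Qed.

Ltac comp_codes :=
  first [ simple apply comp_chead | simple apply comp_ctail | simple apply comp_ccons
        | simple apply comp_code | simple apply comp_decode ].
Ltac comp_ext ::= first [comp_nat | comp_bool | comp_eq | comp_iters | comp_codes].

(** * Course-of-values recursion and list functions *)

Section StrongRecursion.
Context {X A B T : Type} {EX : Enc X} {ET : Enc T} {EB : Enc B} {EA : Enc A}.

(* Course-of-values recursion: [tb] lists the values at all codes below the
   current one, in decreasing order of codes. *)
Lemma comp_srec (F : A -> T -> B) (h : nat -> nat -> seq nat -> nat)
    (a : X -> A) (t : X -> T) :
    Comp (fun p : nat * (nat * seq nat) => h p.1 p.2.1 p.2.2) ->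
    (forall x t tb,
      (forall t', enc t' < enc t -> nth 0 tb ((enc t).-1 - enc t') = enc (F x t')) ->
      h (enc x) (enc t) tb = enc (F x t)) ->
  Comp a -> Comp t -> Comp (fun x => F (a x) (t x)).
Proof.
(* New values are put at the head, so the value at [i] sits at position [n.-1 - i] of [tbl x n]. The
   table runs over all numbers, whether or not they are codes. *)
move=> ch hE ca ct; pose tbl x n := iteri n (fun i r => h x i r :: r) [::].
have tblE x n i : i < n -> nth 0 (tbl x n) (n.-1 - i) = h x i (tbl x i).
  elim: n => // n IHn; rewrite ltnS leq_eqVlt => /predU1P[->|lt_in] /=.
    by rewrite subnn.
  case: n lt_in IHn => // m lt_im IHn; rewrite subSn //; exact: IHn.
have [f rf fE] : Comp (fun p : nat * nat => h p.1 p.2 (tbl p.1 p.2)); last first.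
  apply: (@comp_rec2 X A T B _ _ _ _ (fun x y => f (ccons x (ccons y 0)))) ca ct.
    exact: recn_app1 rf rec2_pair.
  move=> x y; have {fE} /= := fE (enc x, enc y) => ->; rewrite {1}/enc/=.
  have [n] := ubnP (enc y); elim: n y => // n IHn y lt_yn.
  apply: hE => t' lt_t'y; rewrite tblE //; apply: IHn.
  exact: leq_trans lt_t'y _.
apply: (comp_comp (a := fun p : nat * nat => (p.1, (p.2, tbl p.1 p.2))) ch).
by rewrite /tbl; comp.
Qed.
End StrongRecursion.

Lemma comp_foldr {X A B} {EX : Enc X} {EA : Enc A} {EB : Enc B}
    (f : X -> A -> B -> B) (b : X -> B) (l : X -> seq A) :
    Comp (fun p : X * (A * B) => f p.1 p.2.1 p.2.2) -> Comp b -> Comp l ->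
  Comp (fun x => foldr (f x) (b x) (l x)).
Proof.
move=> [f' rf fE] [b' rb bE] cl.
pose h x c (tb : seq nat) := if c == 0 then b' x else
  f' (ccons x (ccons (ccons (chead c) (ccons (nth 0 tb (c.-1 - ctail c)) 0)) 0)).
apply: (@comp_srec X X B (seq A) _ _ _ _ (fun x => foldr (f x) (b x)) h id l) => //.
- by rewrite /h; comp.
- move=> x [|a t] tb IH; first by rewrite /h /= bE.
  rewrite /h /= {1}/enc/= /enc_seq /= code_eq0 /= !codeE.
  rewrite (IH t); first by rewrite -(fE (x, (a, _))).
  (* The recursive call is on the tail, whose code [b] is smaller than [2 ^ a * (2 * b + 1)]. *)
  rewrite /enc/= /enc_seq/= code_cons /ccons.
  apply: leq_trans (leq_pmull _ _); last by rewrite expn_gt0.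
  by rewrite ltnS -addnn leq_addr.
- exact: comp_id.
Qed.

Ltac comp_ext ::= first [comp_nat | comp_bool | comp_eq | comp_iters | comp_codes
  | simple apply comp_foldr ].

Section Seq.
Context {X A B : Type} {EX : Enc X} {EA : Enc A} {EB : Enc B}.
Implicit Types (s t : X -> seq A).

Lemma comp_enc (a : X -> A) : Comp a -> Comp (fun x => enc (a x)).
Proof. by apply: (comp_rec1 rec1_id). Qed.

Lemma comp_map (f : X -> A -> B) s :
  Comp (fun p : X * A => f p.1 p.2) -> Comp s -> Comp (fun x => map (f x) (s x)).
Proof.
move=> *; rewrite (_ : (fun x => _) = fun x => foldr (fun a r => f x a :: r) [::] (s x)).
  by comp.
by apply/boolp.funext => x; elim: (s x) => //= ? ? ->.
Qed.

Lemma comp_cat s t : Comp s -> Comp t -> Comp (fun x => s x ++ t x).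
Proof.
move=> *; rewrite (_ : (fun x => _) = fun x => foldr cons (t x) (s x)).
  by comp.
by apply/boolp.funext => x; elim: (s x) => //= ? ? ->.
Qed.

Lemma comp_rcons s (a : X -> A) : Comp s -> Comp a -> Comp (fun x => rcons (s x) (a x)).
Proof.
move=> cs ct; rewrite (_ : (fun x => _) = fun x => foldr cons [:: a x] (s x)).
  by comp.
by apply/boolp.funext => x; elim: (s x) => //= b l ->.
Qed.

Lemma comp_size s : Comp s -> Comp (fun x => size (s x)).
Proof.
move=> *; rewrite (_ : (fun x => _) = fun x => foldr (fun _ n => n.+1) 0 (s x)).
  by comp.
by apply/boolp.funext => x; elim: (s x) => //= ? ? ->.
Qed.
End Seq.
Ltac comp_seq := first [ simple apply comp_enc | simple apply comp_map
  | simple apply comp_cat | simple apply comp_rcons | simple apply comp_size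
  | simple apply comp_foldr ].
Ltac comp_ext ::= first [comp_nat | comp_bool | comp_eq | comp_iters | comp_codes | comp_seq ].

Section Seq2.
Context {X A B : Type} {EX : Enc X} {EA : Enc A} {EB : Enc B}.
Implicit Types (s t : X -> seq A).

Lemma comp_rev s : Comp s -> Comp (fun x => rev (s x)).
Proof.
move=> cs; rewrite (_ : (fun x => _) = fun x => foldr (fun a r => rcons r a) [::] (s x)).
  by comp.
by apply/boolp.funext => x; elim: (s x) => //= b l <-; rewrite rev_cons.
Qed.

Lemma comp_flatten (s : X -> seq (seq A)) : Comp s -> Comp (fun x => flatten (s x)).
Proof.
move=> *; rewrite (_ : (fun x => _) = fun x => foldr cat [::] (s x)).
  by comp.
by apply/boolp.funext => x; elim: (s x) => //= ? ? ->.
Qed.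

Lemma comp_iota (m n : X -> nat) : Comp m -> Comp n -> Comp (fun x => iota (m x) (n x)).
Proof.
move=> cm cn.
rewrite (_ : (fun x => _) = fun x => iteri (n x) (fun i r => rcons r (m x + i)) [::]).
  by comp.
by apply/boolp.funext => x; elim: (n x) => // k /= <-; rewrite -cats1 -(iotaD _ _ 1) addn1.
Qed.

Lemma comp_filter (f : X -> A -> bool) s :
  Comp (fun p : X * A => f p.1 p.2) -> Comp s -> Comp (fun x => filter (f x) (s x)).
Proof.
move=> *; rewrite (_ : (fun x => _) = fun x => foldr (fun a r =>
  if f x a then a :: r else r) [::] (s x)).
  by comp.
by apply/boolp.funext => x; elim: (s x) => //= ? ? ->.
Qed.

Lemma comp_all (f : X -> A -> bool) s :
  Comp (fun p : X * A => f p.1 p.2) -> Comp s -> Comp (fun x => all (f x) (s x)).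
Proof.
move=> *; rewrite (_ : (fun x => _) = fun x => foldr (fun a r => f x a && r) true (s x)).
  by comp.
by apply/boolp.funext => x; elim: (s x) => //= ? ? ->.
Qed.

Lemma comp_has (f : X -> A -> bool) s :
  Comp (fun p : X * A => f p.1 p.2) -> Comp s -> Comp (fun x => has (f x) (s x)).
Proof.
move=> *; rewrite (_ : (fun x => _) = fun x => foldr (fun a r => f x a || r) false (s x)).
  by comp.
by apply/boolp.funext => x; elim: (s x) => //= ? ? ->.
Qed.

Lemma comp_foldl (f : X -> B -> A -> B) (b : X -> B) s :
    Comp (fun p : X * (B * A) => f p.1 p.2.1 p.2.2) -> Comp b -> Comp s ->
  Comp (fun x => foldl (f x) (b x) (s x)).
Proof.
move=> cf cb cs; rewrite (_ : (fun x => _) =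
  fun x => foldr (fun a r => f x r a) (b x) (rev (s x))).
  have cr := comp_rev cs; comp.
by apply/boolp.funext => x; rewrite -foldl_rev revK.
Qed.
End Seq2.
Ltac comp_seq2 := first [ simple apply comp_rev | simple apply comp_flatten
  | simple apply comp_iota | simple apply comp_filter | simple apply comp_all
  | simple apply comp_has | simple apply comp_foldl ].
Ltac comp_ext ::= first [comp_nat | comp_bool | comp_eq | comp_iters | comp_codes
  | comp_seq | comp_seq2 ].

(** * Terms and formulas *)

Instance enc_relsym : Enc relsym := code_relsym.
Instance enc_quantifier : Enc quantifier := code_quantifier.
Instance enc_qconst : Enc qconst := code_qconst.
Instance enc_rterm : Enc rterm := code_rterm.
Instance enc_cterm : Enc cterm := code_cterm.
Instance enc_qform T {ET : Enc T} : Enc (qform T) := code_qform enc.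

Definition cpair a b := ccons a (ccons b 0).

Lemma comp_cpair {X} {EX : Enc X} (a b : X -> nat) :
  Comp a -> Comp b -> Comp (fun x => cpair (a x) (b x)).
Proof. by move=> ca cb; rewrite /cpair; comp. Qed.

Lemma ltn_code_mem a s : a \in s -> a < CodeSeq.code s.
Proof. by move=> /(allP (CodeSeq.ltn_code s)). Qed.

Lemma enc_rtermE :
  ((forall x, enc (RVar x) = CodeSeq.code [:: 0; enc (x : nat * bool)]) *
   (forall q, enc (RConst q) = CodeSeq.code [:: 1; enc q]) *
   (forall s t, enc (RAdd s t) = CodeSeq.code [:: 2; enc s; enc t]) *
   (forall s t, enc (RMul s t) = CodeSeq.code [:: 3; enc s; enc t]) *
   (forall t, enc (ROpp t) = CodeSeq.code [:: 4; enc t]))%type.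
Proof. by []. Qed.

Lemma enc_ctermE :
  ((forall x, enc (CVar x) = CodeSeq.code [:: 0; enc x]) *
   (forall q, enc (CConst q) = CodeSeq.code [:: 1; enc q]) *
   (enc CI = CodeSeq.code [:: 2]) *
   (forall s t, enc (CAdd s t) = CodeSeq.code [:: 3; enc s; enc t]) *
   (forall s t, enc (CMul s t) = CodeSeq.code [:: 4; enc s; enc t]) *
   (forall t, enc (COpp t) = CodeSeq.code [:: 5; enc t]) *
   (forall t, enc (CRe t) = CodeSeq.code [:: 6; enc t]) *
   (forall t, enc (CIm t) = CodeSeq.code [:: 7; enc t]) *
   (forall t, enc (CConj t) = CodeSeq.code [:: 8; enc t]))%type.
Proof. by []. Qed.

Lemma enc_qformE T {ET : Enc T} :
  ((forall r (s t : T), enc (Atom r s t) = CodeSeq.code [:: 0; enc r; enc s; enc t]) *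
   (enc (@Top T) = CodeSeq.code [:: 1]) * (enc (@Bot T) = CodeSeq.code [:: 2]) *
   (forall f : qform T, enc (Neg f) = CodeSeq.code [:: 3; enc f]) *
   (forall fs : seq (qform T), enc (And fs) = CodeSeq.code (4 :: map enc fs)) *
   (forall fs : seq (qform T), enc (Or fs) = CodeSeq.code (5 :: map enc fs)) *
   (forall f g : qform T, enc (Imp f g) = CodeSeq.code [:: 6; enc f; enc g]) *
   (forall f g : qform T, enc (Iff f g) = CodeSeq.code [:: 7; enc f; enc g]))%type.
Proof. by []. Qed.

Section Constructors.
Context {X : Type} {EX : Enc X}.

Lemma comp_node1 {T A} {ET : Enc T} {EA : Enc A} k (F : A -> T) (a : X -> A) :
  (forall x, enc (F x) = CodeSeq.code [:: k; enc x]) ->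
  Comp a -> Comp (fun x => F (a x)).
Proof.
move=> FE; apply: (comp_rec1 (f := fun n => ccons k (ccons n 0))).
  apply: (recn_app2 rec2_ccons (recn_cst _ _)).
  exact: (recn_app2 rec2_ccons (recn_nth _ _) (recn_cst _ _)).
by move=> x; rewrite FE.
Qed.

Lemma comp_node2 {T A B} {ET : Enc T} {EA : Enc A} {EB : Enc B} k
    (F : A -> B -> T) (a : X -> A) (b : X -> B) :
  (forall x y, enc (F x y) = CodeSeq.code [:: k; enc x; enc y]) ->
  Comp a -> Comp b -> Comp (fun x => F (a x) (b x)).
Proof.
move=> FE; apply: (comp_rec2 (f := fun m n => ccons k (ccons m (ccons n 0)))).
  apply: (recn_app2 rec2_ccons (recn_cst _ _)).
  exact: rec2_pair.
by move=> x y; rewrite FE.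
Qed.
End Constructors.

Ltac comp_node := first
  [ simple apply (@comp_node1 _ _ rterm (nat * bool)%type _ _ 0 RVar); [by [] |]
  | simple apply (@comp_node1 _ _ rterm _ _ _ 1 RConst); [by [] |]
  | simple apply (@comp_node2 _ _ rterm _ _ _ _ _ 2 RAdd); [by [] | | ]
  | simple apply (@comp_node2 _ _ rterm _ _ _ _ _ 3 RMul); [by [] | | ]
  | simple apply (@comp_node1 _ _ rterm _ _ _ 4 ROpp); [by [] |]
  | simple apply (@comp_node1 _ _ cterm _ _ _ 0 CVar); [by [] |]
  | simple apply (@comp_node1 _ _ cterm _ _ _ 1 CConst); [by [] |]
  | simple apply (@comp_node2 _ _ cterm _ _ _ _ _ 3 CAdd); [by [] | | ]
  | simple apply (@comp_node2 _ _ cterm _ _ _ _ _ 4 CMul); [by [] | | ]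
  | simple apply (@comp_node1 _ _ cterm _ _ _ 5 COpp); [by [] |]
  | simple apply (@comp_node1 _ _ cterm _ _ _ 6 CRe); [by [] |]
  | simple apply (@comp_node1 _ _ cterm _ _ _ 7 CIm); [by [] |]
  | simple apply comp_cpair ].
Ltac comp_ext ::= first [comp_nat | comp_bool | comp_eq | comp_iters | comp_codes
  | comp_seq | comp_seq2 | comp_node ].

Section QConstructors.
Context {X T : Type} {EX : Enc X} {ET : Enc T}.

(** An encoded object may be produced by computing its code as a number. *)
Lemma comp_via (F : X -> T) (f : X -> nat) :
  (forall x, enc (F x) = f x) -> Comp f -> Comp F.
Proof. by move=> FE [g rg gE]; exists g => // x; rewrite gE FE. Qed.
End QConstructors.

Section QConstructors.
Context {X T : Type} {EX : Enc X} {ET : Enc T}.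

Lemma comp_Atom (r : X -> relsym) (s t : X -> T) :
  Comp r -> Comp s -> Comp t -> Comp (fun x => Atom (r x) (s x) (t x)).
Proof.
move=> cr cs ct; apply: (comp_via
  (f := fun x => CodeSeq.code [:: 0; enc (r x); enc (s x); enc (t x)])) => //.
by comp.
Qed.

Lemma comp_Neg (f : X -> qform T) : Comp f -> Comp (fun x => Neg (f x)).
Proof. exact: (comp_node1 (k := 3)). Qed.

Lemma comp_Imp (f g : X -> qform T) : Comp f -> Comp g -> Comp (fun x => Imp (f x) (g x)).
Proof. exact: (comp_node2 (k := 6)). Qed.

Lemma comp_Iff (f g : X -> qform T) : Comp f -> Comp g -> Comp (fun x => Iff (f x) (g x)).
Proof. exact: (comp_node2 (k := 7)). Qed.

Lemma comp_And (fs : X -> seq (qform T)) : Comp fs -> Comp (fun x => And (fs x)).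
Proof.
move=> cfs; apply: (comp_via (f := fun x => ccons 4 (enc (fs x)))) => //.
by comp.
Qed.

Lemma comp_Or (fs : X -> seq (qform T)) : Comp fs -> Comp (fun x => Or (fs x)).
Proof.
move=> cfs; apply: (comp_via (f := fun x => ccons 5 (enc (fs x)))) => //.
by comp.
Qed.

End QConstructors.
Ltac comp_qnode := first [ simple apply comp_Atom | simple apply comp_Neg
  | simple apply comp_Imp | simple apply comp_Iff | simple apply comp_And | simple apply comp_Or ].
Ltac comp_ext ::= first [comp_nat | comp_bool | comp_eq | comp_iters | comp_codes
  | comp_seq | comp_seq2 | comp_node | comp_qnode ].

Section Cases.
Context {X A : Type} {EX : Enc X} {EA : Enc A}.

Lemma comp_relsym_case (r : X -> relsym) (a b c d : X -> A) :
  Comp r -> Comp a -> Comp b -> Comp c -> Comp d ->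
  Comp (fun x => match r x with Eq => a x | Ne => b x | Le => c x | Lt => d x end).
Proof.
move=> cr ca cb cc cd; rewrite (_ : (fun x => _) = fun x =>
  if enc (r x) == 0 then a x else if enc (r x) == 1 then b x
  else if enc (r x) == 2 then c x else d x).
  by comp.
by apply/boolp.funext => x; case: (r x).
Qed.

Lemma comp_quantifier_case (q : X -> quantifier) (a b : X -> A) :
  Comp q -> Comp a -> Comp b ->
  Comp (fun x => match q x with Ex => a x | All => b x end).
Proof.
move=> cq ca cb; rewrite (_ : (fun x => _) = fun x => if enc (q x) == 0 then a x else b x).
  by comp.
by apply/boolp.funext => x; case: (q x).
Qed.
End Cases.

(** * Structural recursion on terms and formulas *)

Fixpoint rfold B (fv : rvar -> B) (fc : qconst -> B) (fa fm : B -> B -> B)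
    (fo : B -> B) (t : rterm) : B :=
  let F := rfold fv fc fa fm fo in
  match t with
  | RVar x => fv x
  | RConst q => fc q
  | RAdd s t => fa (F s) (F t)
  | RMul s t => fm (F s) (F t)
  | ROpp t => fo (F t)
  end.

Fixpoint cfold B (fv : nat -> B) (fc : qconst -> B) (fi : B) (fa fm : B -> B -> B)
    (fo fre fim fj : B -> B) (t : cterm) : B :=
  let F := cfold fv fc fi fa fm fo fre fim fj in
  match t with
  | CVar x => fv x
  | CConst q => fc q
  | CI => fi
  | CAdd s t => fa (F s) (F t)
  | CMul s t => fm (F s) (F t)
  | COpp t => fo (F t)
  | CRe t => fre (F t)
  | CIm t => fim (F t)
  | CConj t => fj (F t)
  end.

Fixpoint qfold T B (fa : relsym -> T -> T -> B) (ft fb : B) (fn : B -> B)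
    (fand ffor : seq B -> B) (fi fe : B -> B -> B) (f : qform T) : B :=
  let F := qfold fa ft fb fn fand ffor fi fe in
  match f with
  | Atom r s t => fa r s t
  | Top => ft
  | Bot => fb
  | Neg f => fn (F f)
  | And fs => fand (map F fs)
  | Or fs => ffor (map F fs)
  | Imp f g => fi (F f) (F g)
  | Iff f g => fe (F f) (F g)
  end.

(** The induction principle generated by default gives no hypothesis for the formulas inside the
    lists of [And] and [Or]. *)
Lemma qform_nested_ind T (P : qform T -> Prop) :
  (forall r s t, P (Atom r s t)) -> P Top -> P Bot -> (forall f, P f -> P (Neg f)) ->
  (forall fs, foldr (fun f Q => P f /\ Q) True fs -> P (And fs)) ->
  (forall fs, foldr (fun f Q => P f /\ Q) True fs -> P (Or fs)) ->
  (forall f g, P f -> P g -> P (Imp f g)) ->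
  (forall f g, P f -> P g -> P (Iff f g)) -> forall f, P f.
Proof.
move=> Patom Ptop Pbot Pneg Pand Por Pimp Piff; fix IH 1.
case=> [r s t|||g|fs|fs|g1 g2|g1 g2].
- exact: Patom.
- exact: Ptop.
- exact: Pbot.
- exact: Pneg (IH g).
- apply: Pand; elim: fs => [|g fs IHfs] /=; [exact: I | split; [exact: IH | exact: IHfs]].
- apply: Por; elim: fs => [|g fs IHfs] /=; [exact: I | split; [exact: IH | exact: IHfs]].
- exact: Pimp (IH g1) (IH g2).
- exact: Piff (IH g1) (IH g2).
Qed.

Section Folds.
Context {X B : Type} {EX : Enc X} {EB : Enc B}.

(** A node has a larger code than its children, so this is course-of-values recursion on codes. A
    function written as a fold is then computable as soon as its cases are. *)
Lemma comp_rfold (fv : X -> rvar -> B) (fc : X -> qconst -> B)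
    (fa fm : X -> B -> B -> B) (fo : X -> B -> B) (t : X -> rterm) :
    Comp (fun p : X * (nat * bool) => fv p.1 p.2) ->
    Comp (fun p : X * qconst => fc p.1 p.2) ->
    Comp (fun p : X * (B * B) => fa p.1 p.2.1 p.2.2) ->
    Comp (fun p : X * (B * B) => fm p.1 p.2.1 p.2.2) ->
    Comp (fun p : X * B => fo p.1 p.2) -> Comp t ->
  Comp (fun x => rfold (fv x) (fc x) (fa x) (fm x) (fo x) (t x)).
Proof.
move=> [fv' rv vE] [fc' rc cE] [fa' ra aE] [fm' rm mE] [fo' ro oE] ct.
(* For the code [c] of a node, [chead c] is its tag, [a] and [b] are the codes of its first two
   children (or data), and [va], [vb] are the table entries for them. *)
pose h x c (tb : seq nat) :=
  let a := chead (ctail c) in let b := chead (ctail (ctail c)) in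
  let va := nth 0 tb (c.-1 - a) in let vb := nth 0 tb (c.-1 - b) in
  if chead c == 0 then fv' (cpair x a) else if chead c == 1 then fc' (cpair x a)
  else if chead c == 2 then fa' (cpair x (cpair va vb))
  else if chead c == 3 then fm' (cpair x (cpair va vb)) else fo' (cpair x va).
apply: (@comp_srec X X B rterm _ _ _ _
  (fun x => rfold (fv x) (fc x) (fa x) (fm x) (fo x)) h id t) => //.
- by rewrite /h /=; comp.
- move=> x [y|q|s1 s2|s1 s2|s1] tb IH; rewrite /h !enc_rtermE !codeE /=.
  + exact: (vE (x, y)).
  + exact: (cE (x, q)).
  + rewrite !IH; first 1 [exact: (aE (x, (_, _)))]; apply: ltn_code_mem; by rewrite !inE eqxx ?orbT.
  + rewrite !IH; first 1 [exact: (mE (x, (_, _)))]; apply: ltn_code_mem; by rewrite !inE eqxx ?orbT.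
  + rewrite !IH; first 1 [exact: (oE (x, _))]; apply: ltn_code_mem; by rewrite !inE eqxx ?orbT.
- exact: comp_id.
Qed.

Lemma comp_cfold (fv : X -> nat -> B) (fc : X -> qconst -> B) (fi : X -> B)
    (fa fm : X -> B -> B -> B) (fo fre fim fj : X -> B -> B) (t : X -> cterm) :
    Comp (fun p : X * nat => fv p.1 p.2) ->
    Comp (fun p : X * qconst => fc p.1 p.2) -> Comp fi ->
    Comp (fun p : X * (B * B) => fa p.1 p.2.1 p.2.2) ->
    Comp (fun p : X * (B * B) => fm p.1 p.2.1 p.2.2) ->
    Comp (fun p : X * B => fo p.1 p.2) -> Comp (fun p : X * B => fre p.1 p.2) ->
    Comp (fun p : X * B => fim p.1 p.2) -> Comp (fun p : X * B => fj p.1 p.2) ->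
    Comp t ->
  Comp (fun x => cfold (fv x) (fc x) (fi x) (fa x) (fm x) (fo x) (fre x) (fim x) (fj x) (t x)).
Proof.
move=> [fv' rv vE] [fc' rc cE] [fi' ri iE] [fa' ra aE] [fm' rm mE] [fo' ro oE].
move=> [fre' rre reE] [fim' rim imE] [fj' rj jE] ct.
pose h x c (tb : seq nat) :=
  let a := chead (ctail c) in let b := chead (ctail (ctail c)) in
  let va := nth 0 tb (c.-1 - a) in let vb := nth 0 tb (c.-1 - b) in
  if chead c == 0 then fv' (cpair x a) else if chead c == 1 then fc' (cpair x a)
  else if chead c == 2 then fi' x
  else if chead c == 3 then fa' (cpair x (cpair va vb))
  else if chead c == 4 then fm' (cpair x (cpair va vb))
  else if chead c == 5 then fo' (cpair x va)
  else if chead c == 6 then fre' (cpair x va)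
  else if chead c == 7 then fim' (cpair x va) else fj' (cpair x va).
apply: (@comp_srec X X B cterm _ _ _ _
  (fun x => cfold (fv x) (fc x) (fi x) (fa x) (fm x) (fo x) (fre x) (fim x) (fj x)) h id t) => //.
- by rewrite /h /=; comp.
- move=> x [y|q||s1 s2|s1 s2|s1|s1|s1|s1] tb IH; rewrite /h !enc_ctermE !codeE /=.
  + exact: (vE (x, y)).
  + exact: (cE (x, q)).
  + exact: iE.
  + by rewrite !IH; first 1 [exact: (aE (x, (_, _)))]; apply: ltn_code_mem; rewrite !inE eqxx ?orbT.
  + by rewrite !IH; first 1 [exact: (mE (x, (_, _)))]; apply: ltn_code_mem; rewrite !inE eqxx ?orbT.
  + by rewrite !IH; first 1 [exact: (oE (x, _))]; apply: ltn_code_mem; rewrite !inE eqxx ?orbT.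
  + by rewrite !IH; first 1 [exact: (reE (x, _))]; apply: ltn_code_mem; rewrite !inE eqxx ?orbT.
  + by rewrite !IH; first 1 [exact: (imE (x, _))]; apply: ltn_code_mem; rewrite !inE eqxx ?orbT.
  + by rewrite !IH; first 1 [exact: (jE (x, _))]; apply: ltn_code_mem; rewrite !inE eqxx ?orbT.
- exact: comp_id.
Qed.

Context {T : Type} {ET : Enc T}.

Lemma comp_qfold (fa : X -> relsym -> T -> T -> B) (ft fb : X -> B) (fn : X -> B -> B)
    (fand ffor : X -> seq B -> B) (fi fe : X -> B -> B -> B) (f : X -> qform T) :
    Comp (fun p : X * (relsym * (T * T)) => fa p.1 p.2.1 p.2.2.1 p.2.2.2) ->
    Comp ft -> Comp fb -> Comp (fun p : X * B => fn p.1 p.2) ->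
    Comp (fun p : X * seq B => fand p.1 p.2) ->
    Comp (fun p : X * seq B => ffor p.1 p.2) ->
    Comp (fun p : X * (B * B) => fi p.1 p.2.1 p.2.2) ->
    Comp (fun p : X * (B * B) => fe p.1 p.2.1 p.2.2) -> Comp f ->
  Comp (fun x => qfold (fa x) (ft x) (fb x) (fn x) (fand x) (ffor x) (fi x) (fe x) (f x)).
Proof.
move=> [fa' ra aE] [ft' rt tE] [fb' rb bE] [fn' rn nE] [fand' rand andE].
move=> [for' ror orE] [fi' ri iE] [fe' re eE] cf.
pose h x c (tb : seq nat) :=
  let a := chead (ctail c) in let b := chead (ctail (ctail c)) in
  let va := nth 0 tb (c.-1 - a) in let vb := nth 0 tb (c.-1 - b) in
  let vs := CodeSeq.code [seq nth 0 tb (c.-1 - k) | k <- CodeSeq.decode (ctail c)] in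
  if chead c == 0 then
    fa' (cpair x (cpair a (cpair b (chead (ctail (ctail (ctail c)))))))
  else if chead c == 1 then ft' x else if chead c == 2 then fb' x
  else if chead c == 3 then fn' (cpair x va)
  else if chead c == 4 then fand' (cpair x vs)
  else if chead c == 5 then for' (cpair x vs)
  else if chead c == 6 then fi' (cpair x (cpair va vb))
  else fe' (cpair x (cpair va vb)).
apply: (@comp_srec X X B (qform T) _ _ _ _ (fun x =>
  qfold (fa x) (ft x) (fb x) (fn x) (fand x) (ffor x) (fi x) (fe x)) h id f) => //;
    last exact: comp_id.
  by rewrite /h /=; comp.
(* Under [And] and [Or] the values of all children are fetched from the table; each child has a code
   below that of the node. *)
have vsE x k fs tb (c := CodeSeq.code (k :: map enc fs)) :
    (forall t', enc t' < c -> nth 0 tb (c.-1 - enc t') =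
      enc (qfold (fa x) (ft x) (fb x) (fn x) (fand x) (ffor x) (fi x) (fe x) t')) ->
    CodeSeq.code [seq nth 0 tb (c.-1 - k) | k <- CodeSeq.decode (CodeSeq.code (map enc fs))] =
    enc (map (qfold (fa x) (ft x) (fb x) (fn x) (fand x) (ffor x) (fi x) (fe x)) fs).
  move=> IH; rewrite CodeSeq.codeK [RHS]/enc /enc_seq -!map_comp; congr CodeSeq.code.
  have : {subset map enc fs <= fun n => n < c}.
    by move=> n n_fs; apply: ltn_code_mem; rewrite inE n_fs orbT.
  elim: (fs) => //= f0 fs' IHfs lt_fs; rewrite IHfs; last first.
    by move=> n n_fs; apply: lt_fs; rewrite inE n_fs orbT.
  by rewrite IH //; apply: lt_fs; rewrite inE eqxx.
move=> x [r s t|||g|fs|fs|g1 g2|g1 g2] tb IH; rewrite /h ?enc_qformE ?codeE /=.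
+ exact: (aE (x, (r, (s, t)))).
+ exact: tE.
+ exact: bE.
+ by rewrite !IH; first 1 [exact: (nE (x, _))]; apply: ltn_code_mem; rewrite !inE eqxx ?orbT.
+ rewrite (vsE x 4 fs) //.
  exact: (andE (x, _)).
+ rewrite (vsE x 5 fs) //; exact: (orE (x, _)).
+ by rewrite !IH; first 1 [exact: (iE (x, (_, _)))]; apply: ltn_code_mem; rewrite !inE eqxx ?orbT.
+ by rewrite !IH; first 1 [exact: (eE (x, (_, _)))]; apply: ltn_code_mem; rewrite !inE eqxx ?orbT.
Qed.
End Folds.

(** * Signs of a polynomial on an interval *)

Section Segment.
Local Open Scope ring_scope.
Variable R : rcfType.
Implicit Types (p : {poly R}) (lo hi : option R) (t s : R).

(** An end point [None] stands for minus infinity as [lo] and for plus infinity as [hi]. At such an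
    end, the sign of a polynomial below means its eventual sign. *)
Definition above lo t := if lo is Some a then a < t else true.
Definition below hi t := if hi is Some b then t < b else true.

Definition left_sign p lo s :=
  if lo is Some a then Num.sg p.[a] = s
  else exists M, forall t, t <= M -> Num.sg p.[t] = s.
Definition right_sign p hi s :=
  if hi is Some b then Num.sg p.[b] = s
  else exists M, forall t, M <= t -> Num.sg p.[t] = s.

Lemma left_signN p lo s : left_sign p lo s -> left_sign (- p) lo (- s).
Proof.
case: lo => [a|] /=; first by rewrite hornerN sgrN => ->.
by move=> [M pM]; exists M => t /pM; rewrite hornerN sgrN => ->.
Qed.

Lemma right_signN p hi s : right_sign p hi s -> right_sign (- p) hi (- s).
Proof.
case: hi => [a|] /=; first by rewrite hornerN sgrN => ->.
by move=> [M pM]; exists M => t /pM; rewrite hornerN sgrN => ->.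
Qed.

(** Makes finite and infinite ends uniform: the witness is the end point itself, or a point far
    enough to the left. *)
Lemma left_sign_witness p lo s t : left_sign p lo s -> above lo t ->
  exists u, [/\ u < t, Num.sg p.[u] = s & forall c, u < c -> above lo c].
Proof.
case: lo => [a|] /=; first by exists a.
move=> [M pM] _; exists (Num.min M (t - 1)); split=> //.
  by rewrite gt_min ltrBlDr ltrDl ltr01 orbT.
by rewrite pM // ge_min lexx.
Qed.

Lemma right_sign_witness p hi s t : right_sign p hi s -> below hi t ->
  exists w, [/\ t < w, Num.sg p.[w] = s & forall c, c < w -> below hi c].
Proof.
case: hi => [a|] /=; first by exists a.
move=> [M pM] _; exists (Num.max M (t + 1)); split=> //.
  by rewrite lt_max ltrDl ltr01 orbT.
by rewrite pM // le_max lexx.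
Qed.

(** The behaviour of a strictly monotone polynomial: opposite nonzero end signs give one sign
    change, and otherwise the sign inside is constant. A zero at one end is left immediately, so the
    sign at the other end prevails. *)
Definition segment_signs p lo hi sl sr :=
  if sl * sr == -1 then
    exists x, [/\ above lo x, below hi x, p.[x] = 0,
      forall t, above lo t -> t < x -> Num.sg p.[t] = sl &
      forall t, x < t -> below hi t -> Num.sg p.[t] = sr]
  else forall t, above lo t -> below hi t ->
    Num.sg p.[t] = if sl == 0 then sr else sl.

Lemma above_lt lo t u : above lo t -> t < u -> above lo u.
Proof. by case: lo => //= a; apply: lt_trans. Qed.

Lemma below_lt hi t u : below hi u -> t < u -> below hi t.
Proof. by case: hi => //= a ua /lt_trans; apply. Qed.

(** By the mean value theorem [p] is strictly increasing, so each value inside the segment lies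
    strictly between the values of [p] at two witnesses for the end signs. This settles the sign
    unless the end signs are opposite; then the intermediate value theorem gives the root. *)
Lemma segment_signs_incr p lo hi sl sr :
    (exists t, above lo t /\ below hi t) ->
    (forall t, above lo t -> below hi t -> 0 < p^`().[t]) ->
    left_sign p lo sl -> right_sign p hi sr ->
  segment_signs p lo hi sl sr.
Proof.
move=> [t0 [lt0 th0]] dp pl pr.
have incr u w : u < w -> (forall c, u < c -> above lo c) ->
    (forall c, c < w -> below hi c) -> p.[u] < p.[w].
  move=> uw lu wh; have [c /[!inE] /andP[uc cw] pE] := poly_mvt p uw.
  by rewrite -subr_gt0 pE mulr_gt0 ?subr_gt0 // dp ?lu ?wh.
have left_val t : above lo t -> below hi t -> exists2 u, p.[u] < p.[t] & Num.sg p.[u] = sl.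
  move=> lt th; have [u [ut pu lu]] := left_sign_witness pl lt; exists u => //.
  by apply: incr => // c ct; apply: below_lt th ct.
have right_val t : above lo t -> below hi t -> exists2 u, p.[t] < p.[u] & Num.sg p.[u] = sr.
  move=> lt th; have [u [ut pu lu]] := right_sign_witness pr th; exists u => //.
  by apply: incr => // c ct; apply: above_lt lt ct.
rewrite /segment_signs; case: ifP => [slr|slr t lt th]; last first.
  have [u ut pu] := left_val t lt th; have [w tw pw] := right_val t lt th.
  move: slr; rewrite -pu -pw.
  case: (sgrP p.[u]) ut => [->|u_gt0|u_lt0] ut.
  - by move=> _; rewrite eqxx (gtr0_sg ut) gtr0_sg // (lt_trans ut).
  - by move=> _; rewrite oner_eq0 gtr0_sg ?(lt_trans u_gt0).
  - case: (sgrP p.[w]) tw => [->|w_gt0|w_lt0] tw; rewrite oppr_eq0 oner_eq0.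
    + by rewrite (ltr0_sg tw).
    + by rewrite mulr1 eqxx.
    + by rewrite ltr0_sg // (lt_trans tw).
have [u [ut pu lu]] := left_sign_witness pl lt0.
have [w [tw pw wh]] := right_sign_witness pr th0.
have uw := lt_trans ut tw.
have [x /[!inE] /andP[ux xw] px0] : {x : R | x \in `]u, w[ & root p x}.
  apply: poly_ivtoo; first exact: ltW.
  by rewrite -sgr_lt0 sgrM pu pw (eqP slr) ltrN10.
have lx := lu x ux; have xh := wh x xw.
exists x; split=> //; first exact/eqP.
- move=> t lt tx; have th := below_lt xh tx.
  have pt : p.[t] < 0.
    rewrite -(eqP px0); apply: incr => // c; first exact: above_lt.
    exact: below_lt.
  have [u' u't pu'] := left_val t lt th.
  by rewrite -pu' !ltr0_sg // (lt_trans u't).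
- move=> t xt th; have lt := above_lt lx xt.
  have pt : 0 < p.[t].
    rewrite -(eqP px0); apply: incr => // c; first exact: above_lt.
    exact: below_lt.
  have [u' u't pu'] := right_val t lt th.
  by rewrite -pu' !gtr0_sg // (lt_trans pt).
Qed.

Lemma segment_signsN p lo hi sl sr :
  segment_signs (- p) lo hi (- sl) (- sr) -> segment_signs p lo hi sl sr.
Proof.
rewrite /segment_signs mulrNN oppr_eq0; case: ifP => _.
  move=> [x [lx xh px pl pr]]; exists x; split=> //.
  - by apply/eqP; rewrite -oppr_eq0 -hornerN px.
  - by move=> t lt tx; apply/oppr_inj; rewrite -sgrN -hornerN pl.
  - by move=> t xt th; apply/oppr_inj; rewrite -sgrN -hornerN pr.
move=> pt t lt th; apply/oppr_inj; rewrite -sgrN -hornerN pt //.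
by case: ifP.
Qed.

(** A nonzero polynomial has no root strictly between a point and its next root, whereas here every
    point of the segment is a root. *)
Lemma poly_zero_segment p lo hi : (exists t, above lo t /\ below hi t) ->
  (forall t, above lo t -> below hi t -> p.[t] = 0) -> p = 0.
Proof.
move=> [t0 [lt0 th0]] p0; apply/eqP/negPn/negP => pN0.
have [t1 t01 t1h] : exists2 t1, t0 < t1 & forall c, c < t1 -> below hi c.
  (* The zero polynomial only serves to invoke [right_sign_witness], which supplies [t1]. *)
  have : right_sign 0 hi 0.
    by case: (hi) => /= [b|]; [|exists 0 => t _]; rewrite horner0 sgr0.
  by move=> /right_sign_witness /(_ th0) [w [? _ ?]]; exists w.
have yt0 := next_root_gt t01 pN0; set y := next_root p t0 t1 in yt0.
have := next_root_in p t0 t1; rewrite -/y max_l ?ltW // => /[!inE] /andP[_ yt1].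
have [zt0 zy] := midf_lt yt0.
suff : ~~ root p ((t0 + y) / 2%:R).
  move/rootP; apply; apply: p0; first exact: above_lt zt0.
  exact: t1h (lt_le_trans zy yt1).
by apply: (@next_noroot _ p t0 t1); rewrite in_itv /= zt0 zy.
Qed.

(** The constant sign [d] cannot be 0, since the derivative would then vanish on a whole segment; a
    negative [d] is reduced to a positive one by passing to [- p]. *)
Lemma segment_signsP p lo hi sl sr d :
    (exists t, above lo t /\ below hi t) -> p^`() != 0 ->
    (forall t, above lo t -> below hi t -> Num.sg p^`().[t] = d) ->
    left_sign p lo sl -> right_sign p hi sr ->
  segment_signs p lo hi sl sr.
Proof.
move=> ne dp0 dpd pl pr; have [t0 [lt0 th0]] := ne.
case: (sgrP p^`().[t0]) (dpd _ lt0 th0) => _ dE.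
- case/eqP: dp0; apply: (poly_zero_segment ne) => t lt th.
  by apply/eqP; rewrite -sgr_eq0 dpd // -dE.
- by apply: segment_signs_incr => // t lt th; rewrite -sgr_gt0 dpd // -dE.
- apply: segment_signsN; apply: segment_signs_incr.
  + exact: ne.
  + by move=> t lt th; rewrite derivN hornerN oppr_gt0 -sgr_lt0 dpd // -dE oppr_lt0.
  + exact: left_signN.
  + exact: right_signN.
Qed.
End Segment.

(** * Formal polynomials *)

Lemma code_inj : injective CodeSeq.code.
Proof. exact: can_inj CodeSeq.codeK. Qed.

(** Constants are nonnegative, so taking the absolute value of the numerator loses nothing. *)
Lemma code_qconst_inj : injective code_qconst.
Proof.
move=> q q' /code_inj [numE denE]; apply: val_inj.
case: q q' numE denE => [q q0] [q' q'0] /= numE denE.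
rewrite -[q]divq_num_den -[q']divq_num_den.
have nE (r : rat) : (0 <= r)%R -> numq r = `|numq r|%N.
  by move=> r0; rewrite gez0_abs // numq_ge0.
by rewrite nE // [in RHS]nE // numE -(absz_denq q) -(absz_denq q') denE.
Qed.

Lemma code_rterm_inj : injective code_rterm.
Proof.
elim=> [[z b]|q|s IHs t IHt|s IHs t IHt|t IHt] [[z' b']|q'|s' t'|s' t'|t'] //= /code_inj //.
- by move=> [] /code_inj [-> bE]; rewrite -[b]oddb -[b']oddb bE.
- by move=> [] /code_qconst_inj ->.
- by move=> [] /IHs -> /IHt ->.
- by move=> [] /IHs -> /IHt ->.
- by move=> [] /IHt ->.
Qed.

HB.instance Definition _ := Equality.copy rterm (inj_type code_rterm_inj).

Definition rzero := RConst qconst0.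
Definition qconst1 : qconst := Sub 1%R ler01.
Definition rone := RConst qconst1.
Definition rsub s t := RAdd s (ROpp t).

(* A formal polynomial in the eliminated variable, leading coefficient first;
   leading coefficients may vanish under a given valuation. *)
Notation pol := (seq rterm).

Lemma enc_pol_inj : injective (enc : pol -> nat).
Proof. by move=> p q /code_inj /(inj_map code_rterm_inj). Qed.

(** The suffix [low] marks lists with the constant coefficient first, which suits sums and products;
    [topoly] reverses the result. *)
Definition addlow (p q : pol) : pol :=
  [seq RAdd (nth rzero p i) (nth rzero q i) | i <- iota 0 (maxn (size p) (size q))].
Definition mullow (p q : pol) : pol :=
  foldr (fun a r => addlow (map (RMul a) q) (rzero :: r)) [::] p.
Definition topoly_low (x : rvar) : rterm -> pol :=
  rfold (fun y => if (y.1 == x.1) && (y.2 == x.2) then [:: rzero; rone] else [:: RVar y])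
    (fun q => [:: RConst q]) addlow mullow (map ROpp).
Definition topoly x t := rev (topoly_low x t).

(** The coefficient at position [i] goes with the exponent [size p - i.+1]; its multiple by this
    exponent is written as a repeated sum. *)
Definition pderiv (p : pol) : pol :=
  [seq iter (size p - i.+1) (RAdd (nth rzero p i)) rzero | i <- iota 0 (size p).-1].
(* The leading terms cancel, and [f] is multiplied by a square, so its sign is
   kept at the roots of [g]. *)
Definition pstep (g f : pol) : pol :=
  [seq rsub (RMul (RMul (head rzero g) (head rzero g)) (nth rzero f i))
            (RMul (RMul (head rzero f) (head rzero g)) (nth rzero g i))
  | i <- iota 1 (size f).-1].
(** Each step lowers the size by one, so for [0 < size g <= size f] the result has size
    [(size g).-1]. The number of steps depends on the formal sizes only, not on the valuation. *)
Definition prem (f g : pol) := iter (size f - size g).+1 (pstep g) f.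

Section Eval.
Local Open Scope ring_scope.
Variables (R : realType) (e : rvar -> R).

Definition evp (p : pol) : {poly R} :=
  \poly_(k < size p) reval e (nth rzero p (size p - k.+1)).

Lemma reval0 : reval e rzero = 0.
Proof. by rewrite /= rmorph0. Qed.

Lemma coef_evp p k :
  (evp p)`_k = if (k < size p)%N then reval e (nth rzero p (size p - k.+1)) else 0.
Proof. exact: coef_poly. Qed.

Lemma coef_evp_low p k : (evp (rev p))`_k = reval e (nth rzero p k).
Proof.
rewrite coef_evp size_rev; case: ltnP => [lt_kp|le_pk].
  rewrite nth_rev; last by rewrite ltn_subrL; case: (size p) lt_kp.
  by congr (reval e (nth _ _ _)); rewrite -subSn // subSS subKn // ltnW.
by rewrite nth_default // reval0.
Qed.

Lemma evp_nil : evp [::] = 0.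
Proof. by rewrite /evp poly_def big_ord0. Qed.

Lemma evp_behead f : reval e (head rzero f) = 0 -> evp (behead f) = evp f.
Proof.
case: f => [|a f] //= a0; apply/polyP => k; rewrite !coef_evp /= ltnS.
case: ltngtP => // [lt_kf|->]; last by rewrite subnn.
by rewrite subSn.
Qed.

Lemma size_evp f : f != [::] -> reval e (head rzero f) != 0 ->
  size (evp f) = size f.
Proof.
case: f => // a f _ a0; apply: size_poly_eq.
by rewrite subnn /=.
Qed.

Lemma lead_coef_evp f : f != [::] -> reval e (head rzero f) != 0 ->
  lead_coef (evp f) = reval e (head rzero f).
Proof.
move=> fN0 a0; rewrite lead_coefE size_evp // coef_evp.
by case: f fN0 {a0} => //= a f _; rewrite ltnSn subnn.
Qed.

Lemma evp_neq0 f : f != [::] -> reval e (head rzero f) != 0 -> evp f != 0.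
Proof. by move=> fN0 a0; rewrite -size_poly_gt0 size_evp //; case: f fN0 {a0}. Qed.

Lemma size_pderiv f : size (pderiv f) = (size f).-1.
Proof. by rewrite size_map size_iota. Qed.

Lemma evp_pderiv f : evp (pderiv f) = (evp f)^`().
Proof.
apply/polyP => k; rewrite coef_deriv !coef_evp size_pderiv.
rewrite -[X in (_ < X)%N]subn1 ltn_subRL add1n.
case: ltnP => [lt_kf|]; last by rewrite mul0rn.
rewrite (nth_map 0%N); last first.
  by rewrite size_iota -subn1 -subnDA ltn_sub2l // (leq_ltn_trans _ lt_kf).
rewrite nth_iota ?add0n; last by rewrite -subn1 -subnDA ltn_sub2l // (leq_ltn_trans _ lt_kf).
rewrite -subn1 -subnDA add1n.
rewrite -subSn // subSS subKn; last exact: ltnW.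
by elim: {1 4}k.+1 => [|n IHn]; rewrite ?mulr0n ?reval0 // iterS /= IHn mulrS.
Qed.

Lemma evp_pstep f g : g != [::] -> (size g <= size f)%N ->
  evp (pstep g f) = (reval e (head rzero g) ^+ 2) *: evp f -
    (reval e (head rzero f) * reval e (head rzero g)) *: ('X^(size f - size g) * evp g).
Proof.
case: g => // b g _; case: f => // a f; move=> le_gf;
  rewrite [size (a :: f)]/= [size (b :: g)]/= subSS [head _ _]/=.
have {}le_gf : (size g <= size f)%N := le_gf.
apply/polyP => k; rewrite coefB !coefZ coefXnM !coef_evp size_map size_iota [_.-1]/=.
rewrite /=.
(* Here [f] and [g] denote the tails, so [size f] is the exponent of the leading term, where the two
   products cancel. *)
case: (ltngtP k (size f)) => [lt_kf|lt_fk|->].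
- rewrite (nth_map 0%N) ?size_iota; last by rewrite /=; lia.
  rewrite nth_iota; last by rewrite /=; lia.
  have -> : (k < (size f).+1)%N by lia.
  have -> : (1 + (size f - k.+1) = (size f).+1 - k.+1)%N by lia.
  rewrite {1}/rsub [LHS]/= -expr2; congr (_ - _ * _).
  case: ltnP => [lt_k|le_k].
    by rewrite nth_default ?reval0 //=; move: (size f) (size g) le_gf lt_kf lt_k => m n; lia.
  have -> : (k - (size f - size g) < (size g).+1)%N.
    by move: (size f) (size g) le_gf lt_kf le_k => m n; lia.
  congr (reval e (nth _ _ _)).
  by move: (size f) (size g) le_gf lt_kf le_k => m n; lia.
- move: (size f) (size g) le_gf lt_fk => m n le_nm lt_mk.
  have -> : (k < m.+1)%N = false by lia.
  have -> : (k < m - n)%N = false by lia.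
  have -> : (k - (m - n) < n.+1)%N = false by lia.
  by rewrite !mulr0 subr0.
- move: (size f) (size g) le_gf => m n le_nm.
  have -> : (m < m - n)%N = (m < m)%N by lia.
  rewrite ltnn ltnSn.
  have -> : (m - (m - n) < n.+1)%N by lia.
  have -> : (n.+1 - (m - (m - n)).+1 = 0)%N by lia.
  by rewrite subnn /= expr2 [_ * reval e a]mulrC mulrA subrr.
Qed.

Lemma size_pstep g f : size (pstep g f) = (size f).-1.
Proof. by rewrite size_map size_iota. Qed.

Lemma size_prem f g : (size (prem f g) = size f - (size f - size g).+1)%N.
Proof.
rewrite /prem; elim: _.+1 => [|n IHn]; first by rewrite subn0.
by rewrite iterS size_pstep IHn; lia.
Qed.

Lemma prem_sgr f g x : g != [::] -> reval e (head rzero g) != 0 ->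
    (size g <= size f)%N -> (evp g).[x] = 0 ->
  Num.sg (evp (prem f g)).[x] = Num.sg (evp f).[x].
Proof.
move=> gN0 b0 le_gf gx0; rewrite /prem.
(* This bound says that before each step the current polynomial is still at least as long as [g], as
   [evp_pstep] requires. *)
have : ((size f - size g).+1 + size g <= (size f).+1)%N by lia.
have szh n : size (iter n (pstep g) f) = (size f - n)%N.
  by elim: n => [|n IHn]; rewrite ?subn0 // iterS size_pstep IHn; lia.
elim: (_ - _).+1 => // n IHn sz; rewrite iterS evp_pstep //; last by rewrite szh; lia.
rewrite hornerD hornerN !hornerZ hornerM gx0 !mulr0 subr0 sgrM.
by rewrite gtr0_sg ?mul1r ?IHn ?exprn_even_gt0 ?b0 ?orbT //; lia.
Qed.

Lemma evp_low_nil : evp (rev [::]) = 0.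
Proof. exact: evp_nil. Qed.

Lemma evp_low_cons a p : evp (rev (a :: p)) = (reval e a)%:P + 'X * evp (rev p).
Proof.
apply/polyP => -[|k]; rewrite coefD coefC coefXM !coef_evp_low /= ?addr0 //.
by rewrite add0r.
Qed.

Lemma evp_addlow p q : evp (rev (addlow p q)) = evp (rev p) + evp (rev q).
Proof.
apply/polyP => k; rewrite coefD !coef_evp_low /addlow.
have [lt_k|le_k] := ltnP k (maxn (size p) (size q)).
  by rewrite (nth_map 0%N) ?size_iota // nth_iota.
rewrite nth_default ?size_map ?size_iota //.
move: le_k; rewrite geq_max => /andP[le_p le_q].
by rewrite !nth_default // !reval0 addr0.
Qed.

Lemma evp_scalelow a p : evp (rev (map (RMul a) p)) = (reval e a) *: evp (rev p).
Proof.
apply/polyP => k; rewrite coefZ !coef_evp_low.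
have [lt_k|le_k] := ltnP k (size p); first by rewrite (nth_map rzero).
by rewrite !nth_default ?size_map // reval0 mulr0.
Qed.

Lemma evp_opplow p : evp (rev (map ROpp p)) = - evp (rev p).
Proof.
apply/polyP => k; rewrite coefN !coef_evp_low.
have [lt_k|le_k] := ltnP k (size p); first by rewrite (nth_map rzero).
by rewrite !nth_default ?size_map // reval0 oppr0.
Qed.

Lemma evp_mullow p q : evp (rev (mullow p q)) = evp (rev p) * evp (rev q).
Proof.
elim: p => [|a p IHp]; first by rewrite evp_low_nil mul0r.
rewrite [mullow _ _]/= evp_addlow evp_scalelow !evp_low_cons reval0 IHp add0r.
by rewrite mulrDl mul_polyC mulrA.
Qed.

Lemma horner_topoly x t v :
  (evp (topoly x t)).[v] = reval [eta e with x |-> v] t.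
Proof.
rewrite /topoly; elim: t => [y|q|s IHs t IHt|s IHs t IHt|t IHt]; rewrite /topoly_low /=.
- rewrite -pair_eqE /= /pair_eq; case: ifP => _.
    by rewrite !evp_low_cons evp_low_nil reval0 /= rmorph1 !hornerE.
  by rewrite evp_low_cons evp_low_nil !hornerE.
- by rewrite evp_low_cons evp_low_nil !hornerE.
- by rewrite evp_addlow hornerD IHs IHt.
- by rewrite evp_mullow hornerM IHs IHt.
- by rewrite evp_opplow hornerN IHt.
Qed.

End Eval.

(** * Sign tables *)

(* Signs are coded by 0 (zero), 1 (positive) and 2 (negative); a [signs] maps
   codes of terms or of formal polynomials to their signs. *)
Notation signs := (seq (nat * nat)).
Definition lookup (k : nat) (c : signs) : nat :=
  foldr (fun p r => if p.1 == k then p.2 else r) 0 c.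
Definition term_sign (sg : signs) (t : rterm) := lookup (enc t) sg.
Definition lead_sign (sg : signs) (f : pol) := term_sign sg (head rzero f).
Definition pol_sign (c : signs) (f : pol) := lookup (enc f) c.
Definition record (f : pol) s (c : signs) : signs := (enc f, s) :: c.
Definition flip s := if s == 1 then 2 else if s == 2 then 1 else 0.

(* The column of the leftmost interval, then, for each root in increasing order,
   the columns at this root and on the interval to its right. *)
Notation table := (signs * seq (signs * signs))%type.

(** Combinatorial counterpart of [segment_signs]: the column of an open interval is either split by
    a new root of [f] or extended by a single sign. *)
Definition split_segment (f : pol) (c : signs) sl sr : table :=
  if [&& sl != 0, sr != 0 & sl != sr]
  then (record f sl c, [:: (record f 0 c, record f sr c)])
  else (record f (if sl == 0 then sr else sl) c, [::]).
Definition point_sign sg (P : seq pol) f (c : signs) :=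
  pol_sign c (prem f (head [::]
    [seq g <- P | [&& ~~ nilp g, pol_sign c g == 0 & lead_sign sg g != 0]])).
(** The roots are processed from right to left. The first component of the accumulator is the sign
    of [f] at the right end of the next interval to be treated, initially at plus infinity. *)
Definition insert_points sg P f (l : seq (signs * signs)) :=
  foldr (fun p acc =>
      (point_sign sg P f p.1,
       (record f (point_sign sg P f p.1) p.1,
        (split_segment f p.2 (point_sign sg P f p.1) acc.1).1) ::
       (split_segment f p.2 (point_sign sg P f p.1) acc.1).2 ++ acc.2))
    (lead_sign sg f, [::]) l.
Definition minfty_sign sg (f : pol) :=
  if odd (size f).-1 then flip (lead_sign sg f) else lead_sign sg f.
Definition insert_row sg P f (T : table) : table :=
  ((split_segment f T.1 (minfty_sign sg f) (insert_points sg P f T.2).1).1,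
   (split_segment f T.1 (minfty_sign sg f) (insert_points sg P f T.2).1).2 ++
   (insert_points sg P f T.2).2).
Definition tail_sign (c : signs) (f : pol) :=
  if nilp f then 0 else pol_sign c (behead f).
(** If the leading coefficient vanishes, [f] has the values of its tail, which is already in the
    table; a formal constant has the sign of its coefficient everywhere; only the remaining case can
    create new roots. *)
Definition insert_pol sg P f (T : table) : table :=
  if nilp f || (lead_sign sg f == 0) then
    (record f (tail_sign T.1 f) T.1,
     [seq (record f (tail_sign p.1 f) p.1, record f (tail_sign p.2 f) p.2) | p <- T.2])
  else if size f == 1 then
    (record f (lead_sign sg f) T.1,
     [seq (record f (lead_sign sg f) p.1, record f (lead_sign sg f) p.2) | p <- T.2])
  else insert_row sg P f T.
Definition insert_all sg (Cs : seq pol) :=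
  foldl (fun st f => (f :: st.1, insert_pol sg st.1 f st.2)) ([::], ([::], [::])) Cs.
Definition columns (T : table) : seq signs :=
  T.1 :: flatten [seq [:: p.1; p.2] | p <- T.2].

(** * Correctness of the sign table *)

Section Table.
Local Open Scope ring_scope.
Variables (R : realType) (e : rvar -> R) (sg : signs).

Definition sgn (a : R) : nat := if a == 0 then 0%N else if 0 < a then 1%N else 2%N.

Local Notation ev f := (evp e f).

Definition correct_at (P : seq pol) (t : R) (c : signs) :=
  forall f, f \in P -> pol_sign c f = sgn (ev f).[t].
(** Recorded for every point of the table because [point_sign] needs such a [g] to divide by. *)
Definition root_of (P : seq pol) (x : R) :=
  exists g, [/\ g \in P, ~~ nilp g, lead_sign sg g != 0%N & (ev g).[x] = 0].

(** The table is read as a description of the part of the line to the right of [lo], with [c] the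
    column of the first interval. *)
Fixpoint valid (P : seq pol) (lo : option R) c (l : seq (signs * signs)) : Prop :=
  match l with
  | [::] => forall t, above lo t -> correct_at P t c
  | p :: l' => exists x,
      [/\ above lo x, forall t, above lo t -> t < x -> correct_at P t c,
          correct_at P x p.1, root_of P x & valid P (Some x) p.2 l']
  end.

Definition sign_val (s : nat) : R := if s == 1%N then 1 else if s == 2%N then -1 else 0.

Lemma sgr_sgn a : Num.sg a = sign_val (sgn a).
Proof.
by rewrite /sign_val /sgn; case: (sgrP a).
Qed.

Lemma sgn_eq a b : Num.sg a = Num.sg b -> sgn a = sgn b.
Proof.
rewrite /sgn; case: (sgrP a) => _; case: (sgrP b) => _ //= /eqP;
by rewrite ?[0 == _]eq_sym ?oppr_eq0 ?oner_eq0 // ?[1 == _]eq_sym ?eqNr ?oner_eq0.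
Qed.

Lemma sgn_eq0 a : (sgn a == 0)%N = (a == 0).
Proof. by rewrite /sgn; case: (sgrP a). Qed.

Lemma sgn0 : sgn 0 = 0%N.
Proof. by rewrite /sgn eqxx. Qed.

Lemma flip_sgn a : flip (sgn a) = sgn (- a).
Proof.
rewrite /sgn oppr_eq0 oppr_gt0; by case: (sgrP a).
Qed.

Lemma pol_sign_record (f g : pol) s c :
  pol_sign (record f s c) g = if f == g then s else pol_sign c g.
Proof.
rewrite /pol_sign /record /=; case: (eqVneq f g) => [->|/eqP neq_fg]; first by rewrite eqxx.
by case: eqP => // /enc_pol_inj.
Qed.

Lemma correct_record P f s c t : s = sgn (ev f).[t] -> correct_at P t c ->
  correct_at (f :: P) t (record f s c).
Proof.
move=> -> cP g; rewrite inE pol_sign_record eq_sym => /predU1P[->|gP].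
  by rewrite eqxx.
by case: eqP => [->|_] //; apply: cP.
Qed.

Lemma root_of_sub P f x : root_of P x -> root_of (f :: P) x.
Proof. by move=> [g [gP ? ? ?]]; exists g; rewrite inE gP orbT. Qed.

Lemma valid_map P f (h : signs -> signs) lo c l :
    (forall c t, correct_at P t c -> correct_at (f :: P) t (h c)) ->
    valid P lo c l ->
  valid (f :: P) lo (h c) [seq (h p.1, h p.2) | p <- l].
Proof.
move=> hP; elim: l lo c => [|p l IHl] lo c /=.
  by move=> cP t /cP; apply: hP.
move=> [x [lx cP xP rP vP]]; exists x; split=> //.
- by move=> t lt /(cP _ lt); apply: hP.
- exact: hP.
- exact: root_of_sub.
- exact: IHl.
Qed.

(** Carries [segment_signsP] over to columns: the derivative belongs to [P], so the column of the
    interval records its constant sign there. *)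
Lemma split_segmentP P f lo hi c al ar (s := split_segment f c (sgn al) (sgn ar)) :
    (exists t, above lo t /\ below hi t) ->
    (forall t, above lo t -> below hi t -> correct_at P t c) ->
    pderiv f \in P -> ev (pderiv f) != 0 ->
    left_sign (ev f) lo (Num.sg al) -> right_sign (ev f) hi (Num.sg ar) ->
  (s.2 = [::] /\
   forall t, above lo t -> below hi t -> correct_at (f :: P) t s.1) \/
  exists p x, [/\ s.2 = [:: p], above lo x, below hi x & [/\
    forall t, above lo t -> t < x -> correct_at (f :: P) t s.1,
    correct_at (f :: P) x p.1, (ev f).[x] = 0 &
    forall t, x < t -> below hi t -> correct_at (f :: P) t p.2]].
Proof.
move=> ne cP dfP df0 fl fr.
have : segment_signs (ev f) lo hi (Num.sg al) (Num.sg ar).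
  apply: (@segment_signsP _ _ _ _ _ _ (sign_val (pol_sign c (pderiv f))) ne _ _ fl fr).
    by rewrite -evp_pderiv.
  by move=> t lt th; rewrite -evp_pderiv (cP t lt th _ dfP) sgr_sgn.
rewrite /segment_signs; have -> : (Num.sg al * Num.sg ar == -1) =
    [&& sgn al != 0, sgn ar != 0 & sgn al != sgn ar]%N.
  rewrite /sgn; case: (sgrP al) => _; case: (sgrP ar) => _;
  by rewrite ?mul0r ?mulr0 ?mul1r ?mulr1 ?mulN1r ?opprK ?[0 == -1]eq_sym ?oppr_eq0
    ?oner_eq0 ?eqxx // ?[1 == -1]eq_sym eqNr oner_eq0.
rewrite /s /split_segment; case: ifP => _ /=; last first.
  move=> fE; left; split=> // t lt th; apply: correct_record; last exact: cP.
  by rewrite -(fun_if sgn); apply: sgn_eq; rewrite fE // (fun_if (@Num.sg R)) sgr_eq0 sgn_eq0.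
move=> [x [lx xh fx0 fltx fgtx]]; right; do 2!eexists; split; [by []|exact: lx|exact: xh|].
split=> //=.
- move=> t lt tx; apply: correct_record; first by apply: sgn_eq; rewrite fltx.
  exact: cP (below_lt xh tx).
- apply: correct_record; first by rewrite fx0 sgn0.
  exact: cP.
- move=> t xt th; apply: correct_record; first by apply: sgn_eq; rewrite fgtx.
  exact: cP (above_lt lx xt) th.
Qed.

Definition closed_pols (C : seq pol) := forall f, f \in C -> ~~ nilp f ->
  [/\ behead f \in C, pderiv f \in C &
      forall g, g \in C -> ~~ nilp g -> (size g <= size f)%N -> prem f g \in C].

Section Insert.
Variables (C P : seq pol) (f : pol).
Hypotheses (closedC : closed_pols C) (fC : f \in C) (PC : {subset P <= C}).
Hypothesis sgC : forall g, g \in C -> ~~ nilp g -> lead_sign sg g = sgn (reval e (head rzero g)).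
(** Polynomials are inserted in order of size, so when [f] is reached [P] contains everything in [C]
    smaller than [f] and nothing larger than [f]. *)
Hypothesis sizeP : forall g, g \in P -> (size g <= size f)%N.
Hypothesis smallP : forall g, g \in C -> (size g < size f)%N -> g \in P.

Lemma lead_neq0 g : g \in C -> ~~ nilp g -> (lead_sign sg g != 0)%N = (reval e (head rzero g) != 0).
Proof. by move=> gC gN0; rewrite sgC // sgn_eq0. Qed.

Lemma nilpE (g : pol) : nilp g = (g == [::]).
Proof. by case: g. Qed.

(** The polynomial [h] picked by the filter vanishes at [x], has a nonzero leading coefficient and
    is not larger than [f]. The remainder of [f] by [h] lies in [C] by closure and is smaller than
    [f], hence its sign at [x] is already recorded. *)
Lemma point_signP x c : ~~ nilp f -> correct_at P x c -> root_of P x ->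
  point_sign sg P f c = sgn (ev f).[x].
Proof.
move=> fN0 cP [g [gP gN0 gl gx]]; rewrite /point_sign.
set Q := [seq _ <- _ | _]; have : g \in Q.
  by rewrite mem_filter gN0 gl gP (cP _ gP) gx sgn0 eqxx.
case QE: Q => [|h Q'] // _ /=; have : h \in Q by rewrite QE inE eqxx.
rewrite mem_filter => /andP[/and3P[hN0 hx hl] hP].
have hC := PC hP; have [_ _ /(_ h hC hN0 (sizeP hP)) hfC] := closedC fC fN0.
rewrite (cP (prem f h)); last first.
  apply: smallP => //; rewrite size_prem; move: fN0 (sizeP hP) hN0; rewrite /nilp.
  by move: (size f) (size h) => m n; lia.
apply: sgn_eq; apply: prem_sgr (sizeP hP) _.
- by rewrite -nilpE.
- by rewrite -lead_neq0.
- by apply/eqP; rewrite -sgn_eq0 -(cP _ hP).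
Qed.

Section Row.
Hypotheses (szf : (1 < size f)%N) (lf : (lead_sign sg f != 0)%N).

Let fN0 : f != [::]. Proof. by apply: contraTneq szf => ->. Qed.
Let fNnil : ~~ nilp f. Proof. by rewrite nilpE. Qed.
Let lf0 : reval e (head rzero f) != 0. Proof. by rewrite -lead_neq0. Qed.
Let dfP : pderiv f \in P.
Proof.
have [_ dfC _] := closedC fC fNnil; apply: smallP => //.
by rewrite size_pderiv; move: szf; case: (size f).
Qed.
Let df0 : ev (pderiv f) != 0.
Proof.
rewrite evp_pderiv -size_poly_eq0 size_deriv size_evp //.
by move: szf; case: (size f) => [|[|n]].
Qed.

Lemma above_nonempty (lo : option R) : exists t, above lo t /\ below None t.
Proof.
by case: lo => [a|]; [exists (a + 1); rewrite /= ltrDl ltr01|exists 0].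
Qed.

Lemma segment_nonempty (lo : option R) x : above lo x -> exists t, above lo t /\ below (Some x) t.
Proof.
case: lo => [a|] /= ax; last by exists (x - 1); rewrite ltrBlDr ltrDl ltr01.
by exists ((a + x) / 2%:R); split; rewrite !midf_lt.
Qed.

(** Beyond the Cauchy bound a polynomial keeps the sign of its leading coefficient. *)
Lemma right_sign_lead : right_sign (ev f) None (Num.sg (reval e (head rzero f))).
Proof.
exists (cauchy_bound (ev f)) => t le_t.
have f0 : ev f != 0 by apply: evp_neq0.
rewrite (sgp_pinftyP (ge_cauchy_bound f0)) ?in_itv /= ?andbT //.
by rewrite /sgp_pinfty lead_coef_evp.
Qed.

Lemma minfty_signE : minfty_sign sg f =
  sgn ((-1) ^+ (size f).-1 * reval e (head rzero f)).
Proof.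
rewrite /minfty_sign sgC // -signr_odd; case: odd; last by rewrite mul1r.
by rewrite flip_sgn mulN1r.
Qed.

Lemma left_sign_lead : left_sign (ev f) None
  (Num.sg ((-1) ^+ (size f).-1 * reval e (head rzero f))).
Proof.
exists (- cauchy_bound (ev f)) => t le_t.
have f0 : ev f != 0 by apply: evp_neq0.
rewrite (sgp_minftyP (le_cauchy_bound f0)) ?in_itv //=.
by rewrite /sgp_minfty lead_coef_evp // size_evp.
Qed.

(** Only the sign of [al] matters: it is the sign of [f] at the left end, and in the induction [al]
    becomes the value of [f] at the point just passed. *)
Lemma insert_pointsP l lo c al : valid P lo c l -> left_sign (ev f) lo (Num.sg al) ->
  let acc := insert_points sg P f l in let s := split_segment f c (sgn al) acc.1 in
  valid (f :: P) lo s.1 (s.2 ++ acc.2).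
Proof.
have root_f x : (ev f).[x] = 0 -> root_of (f :: P) x.
  by move=> fx; exists f; rewrite inE eqxx.
elim: l lo c al => [|p l IHl] lo c al /=.
  move=> cP fl; rewrite cats0 sgC //.
  have := @split_segmentP P f lo None c al (reval e (head rzero f)) (above_nonempty lo) _
    dfP df0 fl right_sign_lead.
  case=> [t lt _|[-> cs]|[p [x [-> lx _ [cl cx fx cr]]]]] /=; first exact: cP.
    by move=> t lt; apply: cs.
  by exists x; split=> //; [exact: root_f | move=> t xt; apply: cr].
move=> [x [lx cP xP rP vP]] fl; rewrite (point_signP fNnil xP rP).
have {}IHl := IHl (Some x) p.2 (ev f).[x] vP erefl.
have := @split_segmentP P f lo (Some x) c al (ev f).[x] (segment_nonempty lx) _ dfP df0 fl erefl.
case=> [|[-> cs]|[q [y [-> ly yx [cl cy fy cr]]]]] /=; first exact: cP.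
  exists x; split=> //; last exact: root_of_sub.
  exact: correct_record.
exists y; split=> //; first exact: root_f.
exists x; split=> //; last exact: root_of_sub.
exact: correct_record.
Qed.

Lemma insert_rowP T : valid P None T.1 T.2 ->
  valid (f :: P) None (insert_row sg P f T).1 (insert_row sg P f T).2.
Proof.
move=> vT; rewrite /insert_row /= minfty_signE.
exact: insert_pointsP vT left_sign_lead.
Qed.
End Row.

Lemma insertP T : valid P None T.1 T.2 ->
  valid (f :: P) None (insert_pol sg P f T).1 (insert_pol sg P f T).2.
Proof.
move=> vT; rewrite /insert_pol; case: ifP => [flat|/norP[fN0 lf]].
  apply: (@valid_map P f (fun c => record f (tail_sign c f) c)) => // c t cP.
  apply: correct_record => //; rewrite /tail_sign; move: flat.
  case: ifP => [|/negbT fN0 /= /eqP lf].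
    by rewrite nilpE => /eqP -> _; rewrite evp_nil horner0 sgn0.
  have [tfC _ _] := closedC fC fN0; rewrite (cP (behead f)); last first.
    by apply: smallP => //; rewrite size_behead; move: fN0; rewrite /nilp; case: (size f).
  by rewrite evp_behead //; apply/eqP; rewrite -sgn_eq0 -sgC // lf.
case: ifP => [/eqP sz1|szN1]; last first.
  by apply: insert_rowP => //; move: fN0 szN1; rewrite /nilp; case: (size f) => [|[|n]].
apply: (@valid_map P f (fun c => record f (lead_sign sg f) c)) => // c t cP.
apply: correct_record => //; rewrite sgC //.
case: (f) sz1 => [|a []] //= _.
by rewrite -[[:: a]]/(rev [:: a]) evp_low_cons evp_low_nil !hornerE.
Qed.
End Insert.

(** The loop invariant at an arbitrary stage, with [P] treated and [B] remaining. The size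
    conditions provide the hypotheses of [insertP] for the first element of [B]. *)
Lemma insert_allP C B P T :
    closed_pols C ->
    (forall g, g \in C -> ~~ nilp g -> lead_sign sg g = sgn (reval e (head rzero g))) ->
    {subset P <= C} -> {subset B <= C} ->
    (forall g, g \in C -> (g \in P) || (g \in B)) ->
    pairwise (fun f g : pol => size f <= size g)%N B ->
    (forall g h, g \in P -> h \in B -> (size g <= size h)%N) ->
    valid P None T.1 T.2 ->
  let st := foldl (fun st f => (f :: st.1, insert_pol sg st.1 f st.2)) (P, T) B in
  {subset C <= st.1} /\ valid st.1 None st.2.1 st.2.2.
Proof.
move=> closedC sgC; elim: B P T => [|f B IHB] P T PC BC CPB sB PB vP /=.
  by split=> // g /CPB; rewrite orbF.
move: sB; rewrite pairwise_cons => /andP[/allP fB sB].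
have fC : f \in C by apply: BC; rewrite inE eqxx.
apply: IHB => //.
- by move=> g; rewrite inE => /predU1P[->|/PC].
- by move=> g gB; apply: BC; rewrite inE gB orbT.
- by move=> g /CPB; rewrite !inE => /or3P[]->; rewrite ?orbT.
- move=> g h; rewrite inE => /predU1P[->|gP] hB; first exact: fB.
  by apply: PB => //; rewrite inE hB orbT.
- apply: (@insertP C) => //.
    by move=> g gP; apply: PB => //; rewrite inE eqxx.
  move=> g gC lt_gf; have := CPB g gC; rewrite inE => /or3P[//|/eqP gf|/fB].
    by rewrite gf ltnn in lt_gf.
  by rewrite leqNgt lt_gf.
Qed.

(** The two halves allow a quantifier over the reals to be replaced by a search through the
    columns. *)
Lemma valid_columns P lo c l : valid P lo c l ->
  (forall t, above lo t -> exists2 d, d \in columns (c, l) & correct_at P t d) /\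
  (forall d, d \in columns (c, l) -> exists t, correct_at P t d).
Proof.
elim: l lo c => [|p l IHl] lo c /=.
  move=> cP; split=> [t lt|d]; first by exists c; rewrite ?inE //; apply: cP.
  have [t [lt _]] := above_nonempty lo.
  by rewrite inE => /eqP ->; exists t; apply: cP.
move=> [x [lx cP xP _ /IHl[le_l cols_l]]]; split=> [t lt|d].
  case: (ltgtP t x) => [tx|xt|->].
  - by exists c; [rewrite inE eqxx | apply: cP].
  - have [d d_l dP] := le_l t xt; exists d => //.
    by move: d_l; rewrite /columns /= !inE => ->; rewrite !orbT.
  - by exists p.1 => //; rewrite /columns /= !inE eqxx orbT.
rewrite /columns /= !inE => /or3P[/eqP->|/eqP->|d_l].
- by have [t [lt tx]] := segment_nonempty lx; exists t; apply: cP.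
- by exists x.
- by apply: cols_l; rewrite /columns /= inE.
Qed.
End Table.

(* Only adds polynomials of size below [d], hence the steps are iterated in
   decreasing order of [d]. *)
Definition cstep d (C : seq pol) : seq pol :=
  C ++ [seq behead g | g <- [seq g <- C | size g == d]]
    ++ [seq pderiv g | g <- [seq g <- C | size g == d]]
    ++ flatten [seq [seq prem f g | g <- [seq g <- C | size g == d]]
               | f <- [seq f <- C | d <= size f]].
(** The sum serves as a crude bound for the sizes occurring in [L]. *)
Definition max_size (L : seq pol) := sumn (map size L).
Definition pol_closure (L : seq pol) := foldr cstep L (iota 1 (max_size L)).
Definition by_size n (C : seq pol) : seq pol :=
  flatten [seq [seq f <- C | size f == d] | d <- iota 0 n.+1].

Lemma mem_cstep d C h : reflect
  [\/ h \in C, exists2 g, g \in C & size g = d /\ (h = behead g \/ h = pderiv g) |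
   exists f g, [/\ f \in C, g \in C, size g = d, d <= size f & h = prem f g]]
  (h \in cstep d C).
Proof.
rewrite /cstep !mem_cat; apply: (iffP or4P) => [[]|[]].
- by constructor 1.
- by move=> /mapP[g]; rewrite mem_filter => /andP[/eqP sg gC] ->; constructor 2; exists g; auto.
- by move=> /mapP[g]; rewrite mem_filter => /andP[/eqP sg gC] ->; constructor 2; exists g; auto.
- move=> /flatten_mapP[f]; rewrite mem_filter => /andP[sf fC] /mapP[g].
  by rewrite mem_filter => /andP[/eqP sg gC] ->; constructor 3; exists f, g.
- by constructor 1.
- move=> [g gC [sg [->|->]]]; [constructor 2|constructor 3]; apply/map_f;
  by rewrite mem_filter sg eqxx.
- move=> [f [g [fC gC sg sf ->]]]; constructor 4; apply/flatten_mapP; exists f.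
    by rewrite mem_filter sf.
  by apply/map_f; rewrite mem_filter sg eqxx.
Qed.

Lemma cstep_small d C h : 0 < d -> h \in cstep d C -> h \in C \/ size h < d.
Proof.
move=> d0 /mem_cstep[hC|[g _ [sg [->|->]]]|[f [g [_ _ sg sf ->]]]]; [by left|right..].
- by rewrite size_behead sg; case: (d) d0.
- by rewrite size_pderiv sg; case: (d) d0.
- by rewrite size_prem sg; move: (size f) sf => n; lia.
Qed.

Lemma pol_closure_spec L : closed_pols (pol_closure L) /\
  forall f, f \in pol_closure L -> size f <= max_size L.
Proof.
set D := max_size L.
have szL f : f \in L -> size f <= D.
  rewrite /D /max_size; elim: (L) => //= g L' IHL; rewrite inE => /predU1P[->|/IHL].
    exact: leq_addr.
  by move=> /leq_trans; apply; apply: leq_addl.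
(* After the steps for sizes [D] down to [d], closure holds for polynomials of size at least [d]. A
   step for a smaller size adds only still smaller polynomials, so what has been achieved is not
   disturbed. *)
suff clo n d : 0 < d -> d + n = D.+1 -> let C := foldr cstep L (iota d n) in
    (forall f, f \in C -> size f <= D) /\
    forall f, f \in C -> d <= size f -> [/\ behead f \in C, pderiv f \in C &
      forall g, g \in C -> d <= size g -> size g <= size f -> prem f g \in C].
  have [szC CP] := clo D 1 isT (add1n D); split=> // f fC fN0.
  have f_gt0 : 0 < size f by rewrite lt0n.
  have [? ? fP] := CP f fC f_gt0; split=> // g gC gN0.
  by apply: fP; rewrite // lt0n.
elim: n d => [|n IHn] d d0 dn /=.
  rewrite addn0 in dn; split=> // f /szL le_f; rewrite dn => lt_f.
  by have := leq_trans lt_f le_f; rewrite ltnn.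
have [|szC CP] := IHn d.+1 isT; first by rewrite addSnnS.
set C := foldr _ _ _ in szC CP *.
have sub : {subset C <= cstep d C} by move=> f fC; apply/mem_cstep; constructor 1.
have big f : f \in cstep d C -> d <= size f -> f \in C.
  by move=> /(cstep_small d0)[] // lt_fd; rewrite leqNgt lt_fd.
split=> [f /(cstep_small d0)[/szC //|/ltnW/leq_trans]|f fC' le_df].
  by apply; rewrite -ltnS -dn addnS ltnS leq_addr.
have fC := big f fC' le_df.
have fP g : g \in C -> d <= size g -> size g <= size f -> prem f g \in cstep d C.
  move=> gC; rewrite leq_eqVlt => /predU1P[sg|lt_dg] le_gf.
    by apply/mem_cstep; constructor 3; exists f, g.
  by apply: sub; have [_ _ ->] := CP f fC (leq_trans lt_dg le_gf).
move: le_df; rewrite leq_eqVlt => /predU1P[sf|lt_df].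
  split; last by move=> g gC' dg; apply: fP => //; apply: big.
    by apply/mem_cstep; constructor 2; exists f; auto.
  by apply/mem_cstep; constructor 2; exists f; auto.
have [bC dC _] := CP f fC lt_df; split; try exact: sub.
by move=> g gC' dg; apply: fP => //; apply: big.
Qed.

Lemma sub_pol_closure L : {subset L <= pol_closure L}.
Proof.
rewrite /pol_closure => f fL; elim: (iota _ _) => //= d s IHs.
by apply/mem_cstep; constructor 1.
Qed.

Lemma mem_by_size n C f : (f \in by_size n C) = (f \in C) && (size f <= n).
Proof.
apply/flatten_mapP/andP => [[d]|[fC le_fn]].
  by rewrite mem_iota add0n ltnS mem_filter => le_dn /andP[/eqP-> ->].
by exists (size f); rewrite ?mem_iota ?ltnS // mem_filter eqxx.
Qed.

Lemma pairwise_by_size n C :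
  pairwise (fun f g : pol => size f <= size g) (by_size n C).
Proof.
rewrite /by_size; elim: n.+1 0 => //= k IHk d; rewrite pairwise_cat IHk andbT.
apply/andP; split; last first.
  elim: (C) => //= f C' IHC; case: eqP => //= sf; rewrite IHC andbT.
  by apply/allP => g; rewrite mem_filter sf => /andP[/eqP ->].
apply/allrelP => f g; rewrite mem_filter => /andP[/eqP-> _] /flatten_mapP[m].
by rewrite mem_iota mem_filter => /andP[/ltnW le_dm _] /andP[/eqP->].
Qed.

(** * Elimination of real quantifiers *)

Section QformFacts.
Variables (T : Type).

Lemma qall_qvars (V : eqType) (tv : T -> seq V) (S : seq V) f :
  {subset qvars tv f <= S} ->
  qall (fun _ s t => {subset tv s <= S} /\ {subset tv t <= S}) f.
Proof.
elim/qform_nested_ind: f => //= [_ s t|fs IH|fs IH|f g IHf IHg|f g IHf IHg] sub.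
- by split=> v vs; apply: sub; rewrite mem_cat vs ?orbT.
- elim: fs IH sub => //= f fs IHfs [IHf /IHfs{}IHfs] sub; split.
    by apply: IHf => v vf; apply: sub; rewrite mem_cat vf.
  by apply: IHfs => v vf; apply: sub; rewrite mem_cat vf orbT.
- elim: fs IH sub => //= f fs IHfs [IHf /IHfs{}IHfs] sub; split.
    by apply: IHf => v vf; apply: sub; rewrite mem_cat vf.
  by apply: IHfs => v vf; apply: sub; rewrite mem_cat vf orbT.
- split; [apply: IHf|apply: IHg] => v vf; apply: sub; by rewrite mem_cat vf ?orbT.
- split; [apply: IHf|apply: IHg] => v vf; apply: sub; by rewrite mem_cat vf ?orbT.
Qed.

Lemma eq_qholds (I J : relsym -> T -> T -> bool) (P : relsym -> T -> T -> Prop) f :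
  (forall r s t, P r s t -> I r s t = J r s t) -> qall P f -> qholds I f = qholds J f.
Proof.
move=> IJ; elim/qform_nested_ind: f => //= [f IH|fs IH|fs IH|f g IHf IHg|f g IHf IHg].
- by move=> /IH->.
- by elim: fs IH => //= f fs IHfs [IHf /IHfs{}IHfs] [/IHf-> /IHfs->].
- by elim: fs IH => //= f fs IHfs [IHf /IHfs{}IHfs] [/IHf-> /IHfs->].
- by move=> [/IHf-> /IHg->].
- by move=> [/IHf-> /IHg->].
Qed.
End QformFacts.

(** Applied to the sign of the difference of the two sides of an atom. *)
Definition sign_holds (r : relsym) (s : nat) : bool :=
  match r with Eq => s == 0 | Ne => s != 0 | Le => (s == 0) || (s == 2) | Lt => s == 2 end.
Definition sign_assignments (ts : seq rterm) : seq signs :=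
  foldr (fun t acc => flatten [seq [seq (enc t, s) :: a | a <- acc] | s <- [:: 0; 1; 2]])
    [:: [::]] ts.
Definition sign_formula t s : qform rterm :=
  if s == 0 then Atom Eq t rzero else if s == 1 then Atom Lt rzero t
  else if s == 2 then Atom Lt t rzero else Bot.
(** Differences of all pairs of terms in the formula are taken: a superset of what the atoms
    require, obtained without inspecting them one by one. *)
Definition atom_pols (x : nat * bool) (th : qform rterm) : seq pol :=
  flatten [seq [seq topoly x (rsub s t) | t <- qvars (fun t => [:: t]) th]
          | s <- qvars (fun t => [:: t]) th].
Definition pol_system (x : nat * bool) (th : qform rterm) : seq pol :=
  by_size (max_size (atom_pols x th)) (pol_closure (atom_pols x th)).
Definition satisfiable (x : nat * bool) (th : qform rterm) (sg : signs) : bool :=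
  has (fun c => qholds (fun r s t => sign_holds r (pol_sign c (topoly x (rsub s t)))) th)
    (columns (insert_all sg (pol_system x th)).2).
Definition elim_exists (x : nat * bool) (th : qform rterm) : qform rterm :=
  Or [seq And [seq sign_formula t (term_sign sg t) | t <- flatten (pol_system x th)]
     | sg <- [seq sg <- sign_assignments (flatten (pol_system x th)) | satisfiable x th sg]].
Definition elim_quantifier (q : quantifier) x th : qform rterm :=
  match q with Ex => elim_exists x th | All => Neg (elim_exists x (Neg th)) end.
Definition real_qe (psi : rformula) : qform rterm :=
  foldr (fun qx th => elim_quantifier qx.1 qx.2 th) (body psi) (quants psi).

Section Correctness.
Local Open Scope ring_scope.
Variables (R : realType).
Implicit Types (e : rvar -> R).

Lemma sign_holdsE r (a b : R) : sign_holds r (sgn (a - b)) = rrel r a b.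
Proof.
have -> : rrel r a b = rrel r (a - b) 0.
  by case: r; rewrite /= ?subr_eq0 ?subr_le0 ?subr_lt0.
by rewrite /sgn; case: r => /=; case: (sgrP (a - b)).
Qed.

Lemma sign_formulaE e t s : rqholds e (sign_formula t s) = (s == sgn (reval e t)).
Proof.
rewrite /sign_formula /rqholds /sgn; case: s => [|[|[|s]]] /=; rewrite ?rmorph0.
all: by case: (sgrP (reval e t)) => // /ltW; rewrite leNgt => /negbTE ->.
Qed.

Lemma sign_assignments_complete e ts : exists2 sg, sg \in sign_assignments ts &
  forall t, t \in ts -> term_sign sg t = sgn (reval e t).
Proof.
elim: ts => [|t ts [sg sgP sgE]]; first by exists [::].
exists ((enc t, sgn (reval e t)) :: sg).
  apply/flatten_mapP; exists (sgn (reval e t)); last exact: map_f.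
  by rewrite /sgn; case: ifP => // _; case: ifP.
move=> s; rewrite /term_sign /= inE; have [/code_rterm_inj->|neq] := eqVneq (enc t) (enc s).
  by [].
by case/predU1P => [st|]; [rewrite st eqxx in neq | apply: sgE].
Qed.

(** Since [sg] gives the true signs of all coefficients, the computed table is valid. The polynomial
    of each atom is in the system, so a column decides [th] at every point where it is correct, and
    [valid_columns] relates columns to points. *)
Lemma satisfiableP e x th sg :
    (forall t, t \in flatten (pol_system x th) -> term_sign sg t = sgn (reval e t)) ->
  satisfiable x th sg <-> exists v, rqholds [eta e with x |-> v] th.
Proof.
move=> sgP; set L := atom_pols x th; set C := pol_closure L.
have [closedC sizeC] := pol_closure_spec L.
have memC f : (f \in pol_system x th) = (f \in C).
  by rewrite mem_by_size andb_idr // => /sizeC.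
have sgC g : g \in C -> ~~ nilp g -> lead_sign sg g = sgn (reval e (head rzero g)).
  case: g => // a g gC _; apply: sgP; apply/flattenP; exists (a :: g).
    by rewrite memC.
  by rewrite inE eqxx.
have [] := @insert_allP R e sg C (pol_system x th) [::] ([::], [::]) closedC sgC.
- by [].
- by move=> f; rewrite memC.
- by move=> f; rewrite memC => ->; rewrite orbT.
- exact: pairwise_by_size.
- by [].
- by [].
rewrite /satisfiable -/(insert_all _ _); set st := insert_all _ _ => stC.
case: st stC => [P [c l]] CP vP; rewrite /= in CP vP.
have thE d v : correct_at e P v d ->
    qholds (fun r s t => sign_holds r (pol_sign d (topoly x (rsub s t)))) th =
    rqholds [eta e with x |-> v] th.
  move=> dP; have := qall_qvars (fun v vS => vS : v \in qvars (fun t => [:: t]) th).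
  apply: eq_qholds => r s t [sth tth].
  rewrite (dP (topoly x (rsub s t))).
    by rewrite horner_topoly sign_holdsE.
  apply/CP/sub_pol_closure/flatten_mapP; exists s; first by apply: sth; rewrite inE.
  by apply: map_f; apply: tth; rewrite inE.
have [colsP ptsP] := valid_columns vP.
split => [/hasP[d d_cols dth]|[v thv]].
  by have [v dv] := ptsP d d_cols; exists v; rewrite -(thE d v dv).
have [//|d d_cols dv] := colsP v.
by apply/hasP; exists d => //; rewrite (thE d v dv).
Qed.

(** A disjunct that holds under [e] forces its assignment to give the true signs; conversely the
    true assignment is among those enumerated. Both ways, [satisfiableP] applies to it. *)
Lemma elim_existsP e x th :
  rqholds e (elim_exists x th) <-> exists v, rqholds [eta e with x |-> v] th.
Proof.
rewrite /elim_exists /rqholds /= has_map.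
have andE sg : qholds (fun r s t => rrel r (reval e s) (reval e t))
      (And [seq sign_formula t (term_sign sg t) | t <- flatten (pol_system x th)]) ->
    forall t, t \in flatten (pol_system x th) -> term_sign sg t = sgn (reval e t).
  by rewrite /= all_map => /allP sgP t /sgP /=; rewrite -/(rqholds _ _) sign_formulaE => /eqP.
split=> [/hasP[sg]|th_v].
  by rewrite mem_filter => /andP[sgth _] /andE /satisfiableP <-.
have [sg sg_in sgP] := sign_assignments_complete e (flatten (pol_system x th)).
apply/hasP; exists sg; first by rewrite mem_filter sg_in andbT; apply/satisfiableP/th_v.
rewrite /= all_map; apply/allP => t /sgP tE /=.
by rewrite -/(rqholds _ _) sign_formulaE tE.
Qed.

Lemma elim_quantifierP e q x th : rqholds e (elim_quantifier q x th) <->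
  pholds [:: (q, x)] (fun e => rqholds e th) e.
Proof.
case: q => /=; first exact: elim_existsP.
rewrite /rqholds /= -/(rqholds _ _); split=> [/negP no_ex v|all_v].
  apply/negPn/negP => nv; apply: no_ex; apply/elim_existsP; exists v.
  by rewrite /rqholds /=.
apply/negP => /elim_existsP[v]; rewrite /rqholds /= => /negP; apply; exact: all_v.
Qed.

Lemma real_qeP e psi : rholds e psi <-> rqholds e (real_qe psi).
Proof.
case: psi => qs th; rewrite /rholds /real_qe /=.
elim: qs e => //= -[[] x] qs IHqs e; rewrite elim_quantifierP /=.
  by split=> -[v /IHqs]; exists v.
by split=> all_v v; apply/IHqs.
Qed.
End Correctness.

(** * Variables occurring in the eliminated formula *)

Section Variables.
Variable V : pred rvar.

Definition term_over (t : rterm) := all V (rvars t).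
Definition pol_over (f : pol) := all term_over f.

Lemma term_overE :
  ((forall s t, term_over (RAdd s t) = term_over s && term_over t) *
   (forall s t, term_over (RMul s t) = term_over s && term_over t) *
   (forall t, term_over (ROpp t) = term_over t))%type.
Proof. by do !split=> // *; rewrite /term_over /= all_cat. Qed.

Lemma nth_over f i : pol_over f -> term_over (nth rzero f i).
Proof. by move=> /(all_nthP rzero) fV; case: (ltnP i (size f)) => [/fV//|?];
  rewrite nth_default. Qed.

Lemma head_over f : pol_over f -> term_over (head rzero f).
Proof. by rewrite -nth0; apply: nth_over. Qed.

Lemma iter_over n t s : term_over t -> term_over s -> term_over (iter n (RAdd t) s).
Proof. by move=> tV sV; elim: n => //= n IHn; rewrite term_overE tV. Qed.

Lemma pderiv_over f : pol_over f -> pol_over (pderiv f).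
Proof.
move=> fV; apply/allP => _ /mapP[i _ ->].
by apply: iter_over => //; apply: nth_over.
Qed.

Lemma behead_over f : pol_over f -> pol_over (behead f).
Proof. by case: f => //= a f /andP[]. Qed.

Lemma pstep_over f g : pol_over f -> pol_over g -> pol_over (pstep g f).
Proof.
move=> fV gV; apply/allP => _ /mapP[i _ ->].
rewrite /rsub /term_over /= !all_cat -!/(term_over _).
by rewrite !(head_over, nth_over).
Qed.

Lemma prem_over f g : pol_over f -> pol_over g -> pol_over (prem f g).
Proof. by move=> fV gV; rewrite /prem; elim: _.+1 => //= n IHn; apply: pstep_over. Qed.

Lemma addlow_over f g : pol_over f -> pol_over g -> pol_over (addlow f g).
Proof.
move=> fV gV; apply/allP => _ /mapP[i _ ->].
by rewrite term_overE !nth_over.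
Qed.

Lemma mullow_over f g : pol_over f -> pol_over g -> pol_over (mullow f g).
Proof.
move=> fV gV; elim: f fV => //= a f IHf /andP[aV /IHf fV].
apply: addlow_over => //; apply/allP => _ /mapP[t /(allP gV) tV ->].
by rewrite term_overE aV.
Qed.

Lemma topoly_over x t : all (fun y => (y == x) || V y) (rvars t) -> pol_over (topoly x t).
Proof.
rewrite /pol_over all_rev -/(pol_over _) /topoly_low.
elim: t => //= [y|s IHs t IHt|s IHs t IHt|t IHt].
- rewrite andbT -pair_eqE /= /pair_eq; case: ifP => //= _ yV.
  by rewrite andbT /term_over /= andbT.
- by rewrite all_cat => /andP[/IHs sV /IHt tV]; apply: addlow_over.
- by rewrite all_cat => /andP[/IHs sV /IHt tV]; apply: mullow_over.
- by move=> /IHt /allP tV; apply/allP => _ /mapP[s /tV sV ->].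
Qed.

Lemma pol_closure_over L : all pol_over L -> all pol_over (pol_closure L).
Proof.
rewrite /pol_closure => LV; elim: (iota _ _) => //= d s /allP IHs.
apply/allP => f /mem_cstep[/IHs //|[g /IHs gV [_ [->|->]]]|[g [h [/IHs gV /IHs hV _ _ ->]]]].
- exact: behead_over.
- exact: pderiv_over.
- exact: prem_over.
Qed.
End Variables.

(** The coefficients produced by [topoly x] do not contain [x], and the closure operations introduce
    no variables; the output speaks only of signs of such coefficients. *)
Lemma elim_exists_vars x th y : y \in qvars rvars (elim_exists x th) ->
  (y \in qvars rvars th) && (y != x).
Proof.
move=> y_in; have {y_in} [t t_in yt] : exists2 t, t \in flatten (pol_system x th) & y \in rvars t.
  move: y_in; rewrite /elim_exists /= -map_comp => /flatten_mapP[sg _] /=.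
  rewrite -map_comp => /flatten_mapP[t t_in] /= yt; exists t => //.
  by move: yt; rewrite /sign_formula; case: ifP => _; [|case: ifP => _; [|case: ifP => _]];
    rewrite /= ?cats0.
pose V := [pred y | (y \in qvars rvars th) && (y != x)].
suff /allP /(_ t t_in) /allP /(_ y yt) : pol_over V (flatten (pol_system x th)) by [].
apply/allP => s /flattenP[f]; rewrite mem_by_size => /andP[f_in _] sf.
suff /allP/(_ f f_in)/allP/(_ s sf) : all (pol_over V) (pol_closure (atom_pols x th)) by [].
apply: pol_closure_over; apply/allP => _ /flatten_mapP[s1 s1_in /mapP[s2 s2_in ->]].
have thV u z : u \in qvars (fun t => [:: t]) th -> z \in rvars u -> z \in qvars rvars th.
  elim/qform_nested_ind: (th) => //= [r a b|fs IH|fs IH|f1 f2 IH1 IH2|f1 f2 IH1 IH2].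
  - by rewrite !inE mem_cat => /orP[/eqP->|/eqP->] ->; rewrite ?orbT.
  - elim: fs IH => //= f1 fs IHfs [IH1 /IHfs IH2]; rewrite !mem_cat.
    by case/orP => [/IH1 IH|/IH2 IH] /IH ->; rewrite ?orbT.
  - elim: fs IH => //= f1 fs IHfs [IH1 /IHfs IH2]; rewrite !mem_cat.
    by case/orP => [/IH1 IH|/IH2 IH] /IH ->; rewrite ?orbT.
  - by rewrite !mem_cat; case/orP => [/IH1 IH|/IH2 IH] /IH ->; rewrite ?orbT.
  - by rewrite !mem_cat; case/orP => [/IH1 IH|/IH2 IH] /IH ->; rewrite ?orbT.
apply: topoly_over; apply/allP => z; rewrite mem_cat /= => z_in; case: eqP => //= _.
by rewrite andbT; case/orP: z_in => /thV; apply.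
Qed.

Lemma real_qe_vars psi : {subset qvars rvars (real_qe psi) <= free_vars rvars psi}.
Proof.
case: psi => qs th y; rewrite /real_qe /free_vars mem_filter /=.
elim: qs => //= -[q x] qs IHqs /= y_in.
have /andP[/IHqs /andP[ynqs ->] yx] :
    (y \in qvars rvars (foldr (fun qx th => elim_quantifier qx.1 qx.2 th) th qs)) && (y != x).
  by move: y_in; case: q => /= /elim_exists_vars.
by rewrite inE negb_or yx ynqs.
Qed.

(** * Computability of the elimination *)

Ltac comp_base := first [comp_nat | comp_bool | comp_eq | comp_iters | comp_codes
  | comp_seq | comp_seq2 | comp_node | comp_qnode | simple apply comp_relsym_case
  | simple apply comp_quantifier_case | simple apply comp_rfold | simple apply comp_cfold
  | simple apply comp_qfold ].
Ltac comp_ext ::= comp_base.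

Section QformOps.
Context {X T : Type} {EX : Enc X} {ET : Enc T}.

Lemma comp_qholds (I : X -> relsym -> T -> T -> bool) (f : X -> qform T) :
    Comp (fun p : X * (relsym * (T * T)) => I p.1 p.2.1 p.2.2.1 p.2.2.2) -> Comp f ->
  Comp (fun x => qholds (I x) (f x)).
Proof.
move=> cI cf; rewrite (_ : (fun x => _) = fun x =>
  qfold (I x) true false negb (all id) (has id) implb (fun a b => a == b) (f x)).
  by comp.
apply/boolp.funext => x; elim/qform_nested_ind: (f x) =>
  //= [g ->|fs IH|fs IH|g h -> ->|g h -> ->] //.
- by elim: fs IH => //= g fs IHfs [-> /IHfs->].
- by elim: fs IH => //= g fs IHfs [-> /IHfs->].
Qed.

Lemma comp_qmap {U} {EU : Enc U} (h : X -> T -> U) (f : X -> qform T) :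
    Comp (fun p : X * T => h p.1 p.2) -> Comp f ->
  Comp (fun x => qmap (h x) (f x)).
Proof.
move=> ch cf; rewrite (_ : (fun x => _) = fun x =>
  qfold (fun r s t => Atom r (h x s) (h x t)) Top Bot (@Neg U) (@And U) (@Or U)
    (@Imp U) (@Iff U) (f x)).
  by comp.
apply/boolp.funext => x; elim/qform_nested_ind: (f x) =>
  //= [g ->|fs IH|fs IH|g k -> ->|g k -> ->] //.
- by congr And; elim: fs IH => //= g fs IHfs [-> /IHfs->].
- by congr Or; elim: fs IH => //= g fs IHfs [-> /IHfs->].
Qed.

Lemma comp_qvars {U} {EU : Enc U} (h : X -> T -> seq U) (f : X -> qform T) :
    Comp (fun p : X * T => h p.1 p.2) -> Comp f ->
  Comp (fun x => qvars (h x) (f x)).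
Proof.
move=> ch cf; rewrite (_ : (fun x => _) = fun x =>
  qfold (fun r s t => h x s ++ h x t) [::] [::] id flatten flatten cat cat (f x)).
  by comp.
apply/boolp.funext => x; elim/qform_nested_ind: (f x) => //= [fs IH|fs IH|g k -> ->|g k -> ->] //.
- by congr flatten; elim: fs IH => //= g fs IHfs [-> /IHfs->].
- by congr flatten; elim: fs IH => //= g fs IHfs [-> /IHfs->].
Qed.

Lemma comp_nilp {A} {EA : Enc A} (s : X -> seq A) : Comp s -> Comp (fun x => nilp (s x)).
Proof. by move=> cs; rewrite /nilp; comp. Qed.
End QformOps.
Ltac comp_qform := first [ simple apply comp_qholds | simple apply comp_qmap
  | simple apply comp_qvars | simple apply comp_nilp ].
Ltac comp_ext ::= first [comp_base | comp_qform].

Section Polynomials.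
Context {X : Type} {EX : Enc X}.
Implicit Types (f g : X -> pol) (t : X -> rterm).

Lemma comp_rsub t t' : Comp t -> Comp t' -> Comp (fun x => rsub (t x) (t' x)).
Proof. by move=> ct ct'; rewrite /rsub; comp. Qed.
Lemma comp_addlow f g : Comp f -> Comp g -> Comp (fun x => addlow (f x) (g x)).
Proof. by move=> cf cg; rewrite /addlow /maxn; comp. Qed.
End Polynomials.
Ltac comp_pol1 := first [ simple apply comp_rsub | simple apply comp_addlow ].
Ltac comp_ext ::= first [comp_base | comp_qform | comp_pol1].

Section Polynomials.
Context {X : Type} {EX : Enc X}.
Implicit Types (f g : X -> pol) (t : X -> rterm) (v : X -> nat * bool).
Lemma comp_mullow f g : Comp f -> Comp g -> Comp (fun x => mullow (f x) (g x)).
Proof. by move=> cf cg; rewrite /mullow; comp. Qed.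
Lemma comp_pderiv f : Comp f -> Comp (fun x => pderiv (f x)).
Proof. by move=> cf; rewrite /pderiv; comp. Qed.
Lemma comp_pstep f g : Comp f -> Comp g -> Comp (fun x => pstep (f x) (g x)).
Proof. by move=> cf cg; rewrite /pstep; comp. Qed.
End Polynomials.
Ltac comp_pol2 := first [ simple apply comp_mullow | simple apply comp_pderiv
  | simple apply comp_pstep ].
Ltac comp_ext ::= first [comp_base | comp_qform | comp_pol1 | comp_pol2].

Section Polynomials.
Context {X : Type} {EX : Enc X}.
Implicit Types (f g : X -> pol) (t : X -> rterm) (v : X -> nat * bool).
Lemma comp_prem f g : Comp f -> Comp g -> Comp (fun x => prem (f x) (g x)).
Proof. by move=> cf cg; rewrite /prem; comp. Qed.
Lemma comp_topoly v t : Comp v -> Comp t -> Comp (fun x => topoly (v x) (t x)).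
Proof. by move=> cv ct; rewrite /topoly /topoly_low; comp. Qed.
End Polynomials.
Ltac comp_pol := first [ comp_pol1 | comp_pol2 | simple apply comp_prem
  | simple apply comp_topoly ].
Ltac comp_ext ::= first [comp_base | comp_qform | comp_pol].

Section Tables.
Context {X : Type} {EX : Enc X}.
Implicit Types (f : X -> pol) (t : X -> rterm) (v : X -> nat * bool) (c sg : X -> signs)
  (n : X -> nat) (C P : X -> seq pol) (T : X -> table) (th : X -> qform rterm).

Lemma comp_lookup n c : Comp n -> Comp c -> Comp (fun x => lookup (n x) (c x)).
Proof. by move=> cn cc; rewrite /lookup; comp. Qed.
Lemma comp_record f n c : Comp f -> Comp n -> Comp c ->
  Comp (fun x => record (f x) (n x) (c x)).
Proof. by move=> cf cn cc; rewrite /record; comp. Qed.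
Lemma comp_flip n : Comp n -> Comp (fun x => flip (n x)).
Proof. by move=> cn; rewrite /flip; comp. Qed.
End Tables.
Ltac comp_tab1 := first [ simple apply comp_lookup | simple apply comp_record
  | simple apply comp_flip ].
Ltac comp_ext ::= first [comp_base | comp_qform | comp_pol | comp_tab1].

Section Tables.
Context {X : Type} {EX : Enc X}.
Implicit Types (f : X -> pol) (t : X -> rterm) (v : X -> nat * bool) (c sg : X -> signs)
  (n : X -> nat) (C P : X -> seq pol) (T : X -> table) (th : X -> qform rterm).

Lemma comp_odd n : Comp n -> Comp (fun x => odd (n x)).
Proof.
move=> cn; rewrite (_ : (fun x => _) = fun x => iter (n x) negb false); first by comp.
by apply/boolp.funext => x; elim: (n x) => //= m ->.
Qed.
Lemma comp_term_sign sg t : Comp sg -> Comp t -> Comp (fun x => term_sign (sg x) (t x)).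
Proof. by move=> cs ct; rewrite /term_sign; comp. Qed.
Lemma comp_lead_sign sg f : Comp sg -> Comp f -> Comp (fun x => lead_sign (sg x) (f x)).
Proof. by move=> cs ct; rewrite /lead_sign /term_sign; comp. Qed.
Lemma comp_pol_sign sg f : Comp sg -> Comp f -> Comp (fun x => pol_sign (sg x) (f x)).
Proof. by move=> cs ct; rewrite /pol_sign; comp. Qed.
Lemma comp_split_segment f c n (m : X -> nat) : Comp f -> Comp c -> Comp n -> Comp m ->
  Comp (fun x => split_segment (f x) (c x) (n x) (m x)).
Proof. by move=> cf cc cn cm; rewrite /split_segment; comp. Qed.
End Tables.
Ltac comp_tab2 := first [ simple apply comp_term_sign | simple apply comp_lead_sign
  | simple apply comp_pol_sign | simple apply comp_split_segment | simple apply comp_odd ].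
Ltac comp_ext ::= first [comp_base | comp_qform | comp_pol | comp_tab1 | comp_tab2].

Section Tables.
Context {X : Type} {EX : Enc X}.
Implicit Types (f : X -> pol) (t : X -> rterm) (v : X -> nat * bool) (c sg : X -> signs)
  (n : X -> nat) (C P : X -> seq pol) (T : X -> table) (th : X -> qform rterm).

Lemma comp_point_sign sg P f c : Comp sg -> Comp P -> Comp f -> Comp c ->
  Comp (fun x => point_sign (sg x) (P x) (f x) (c x)).
Proof. by move=> cs cP cf cc; rewrite /point_sign; comp. Qed.
Lemma comp_minfty_sign sg f : Comp sg -> Comp f -> Comp (fun x => minfty_sign (sg x) (f x)).
Proof. by move=> cs cf; rewrite /minfty_sign; comp. Qed.
Lemma comp_tail_sign c f : Comp c -> Comp f -> Comp (fun x => tail_sign (c x) (f x)).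
Proof. by move=> cc cf; rewrite /tail_sign; comp. Qed.
Lemma comp_columns T : Comp T -> Comp (fun x => columns (T x)).
Proof. by move=> cT; rewrite /columns; comp. Qed.
End Tables.
Ltac comp_tab3 := first [ simple apply comp_point_sign | simple apply comp_minfty_sign
  | simple apply comp_tail_sign | simple apply comp_columns ].
Ltac comp_ext ::= first [comp_base | comp_qform | comp_pol | comp_tab1 | comp_tab2 | comp_tab3].

Section Tables.
Context {X : Type} {EX : Enc X}.
Implicit Types (f : X -> pol) (t : X -> rterm) (v : X -> nat * bool) (c sg : X -> signs)
  (n : X -> nat) (C P : X -> seq pol) (T : X -> table) (th : X -> qform rterm).

Lemma comp_insert_points sg P f (l : X -> seq (signs * signs)) :
  Comp sg -> Comp P -> Comp f -> Comp l ->
  Comp (fun x => insert_points (sg x) (P x) (f x) (l x)).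
Proof. by move=> cs cP cf cl; rewrite /insert_points; comp. Qed.

Lemma comp_insert_row sg P f T : Comp sg -> Comp P -> Comp f -> Comp T ->
  Comp (fun x => insert_row (sg x) (P x) (f x) (T x)).
Proof.
move=> cs cP cf cT; rewrite /insert_row.
(* Established separately so that [comp] finds it as an assumption at each occurrence. *)
have cp : Comp (fun x => insert_points (sg x) (P x) (f x) (T x).2).
  by apply: comp_insert_points; comp.
comp.
Qed.

Lemma comp_insert_pol sg P f T : Comp sg -> Comp P -> Comp f -> Comp T ->
  Comp (fun x => insert_pol (sg x) (P x) (f x) (T x)).
Proof.
move=> cs cP cf cT; rewrite /insert_pol.
have cp := comp_insert_row cs cP cf cT; comp.
Qed.
End Tables.
Ltac comp_tab4 := simple apply comp_insert_pol.
Ltac comp_tab := first [ comp_tab1 | comp_tab2 | comp_tab3 | comp_tab4 ].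
Ltac comp_ext ::= first [comp_base | comp_qform | comp_pol | comp_tab].

Section Elimination.
Context {X : Type} {EX : Enc X}.
Implicit Types (f : X -> pol) (t : X -> rterm) (v : X -> nat * bool) (c sg : X -> signs)
  (n : X -> nat) (C P : X -> seq pol) (T : X -> table) (th : X -> qform rterm).

Lemma comp_insert_all sg C : Comp sg -> Comp C ->
  Comp (fun x => insert_all (sg x) (C x)).
Proof. by move=> cs cC; rewrite /insert_all; comp. Qed.
Lemma comp_cstep n C : Comp n -> Comp C -> Comp (fun x => cstep (n x) (C x)).
Proof. by move=> cn cC; rewrite /cstep; comp. Qed.
Lemma comp_max_size C : Comp C -> Comp (fun x => max_size (C x)).
Proof. by move=> cC; rewrite /max_size /sumn; comp. Qed.
Lemma comp_by_size n C : Comp n -> Comp C -> Comp (fun x => by_size (n x) (C x)).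
Proof. by move=> cn cC; rewrite /by_size; comp. Qed.
Lemma comp_sign_holds (r : X -> relsym) n : Comp r -> Comp n ->
  Comp (fun x => sign_holds (r x) (n x)).
Proof. by move=> cr cn; rewrite /sign_holds; comp. Qed.
Lemma comp_sign_assignments (ts : X -> seq rterm) : Comp ts ->
  Comp (fun x => sign_assignments (ts x)).
Proof. by move=> cts; rewrite /sign_assignments; comp. Qed.
Lemma comp_sign_formula t n : Comp t -> Comp n ->
  Comp (fun x => sign_formula (t x) (n x)).
Proof. by move=> ct cn; rewrite /sign_formula; comp. Qed.
Lemma comp_atom_pols v th : Comp v -> Comp th -> Comp (fun x => atom_pols (v x) (th x)).
Proof. by move=> cv cth; rewrite /atom_pols; comp. Qed.
End Elimination.
Ltac comp_elim1 := first [ simple apply comp_insert_all | simple apply comp_cstep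
  | simple apply comp_max_size | simple apply comp_by_size | simple apply comp_sign_holds
  | simple apply comp_sign_assignments | simple apply comp_sign_formula
  | simple apply comp_atom_pols ].
Ltac comp_ext ::= first [comp_base | comp_qform | comp_pol | comp_tab | comp_elim1].

Section Elimination.
Context {X : Type} {EX : Enc X}.
Implicit Types (v : X -> nat * bool) (sg : X -> signs) (C : X -> seq pol) (th : X -> qform rterm).

Lemma comp_pol_closure C : Comp C -> Comp (fun x => pol_closure (C x)).
Proof. by move=> cC; rewrite /pol_closure; comp. Qed.

Lemma comp_pol_system v th : Comp v -> Comp th -> Comp (fun x => pol_system (v x) (th x)).
Proof.
move=> cv cth; rewrite /pol_system; apply: comp_by_size; first by comp.
by apply: comp_pol_closure; comp.
Qed.

Lemma comp_satisfiable v th sg : Comp v -> Comp th -> Comp sg ->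
  Comp (fun x => satisfiable (v x) (th x) (sg x)).
Proof.
move=> cv cth cs; have cp := comp_pol_system cv cth; rewrite /satisfiable; comp.
Qed.
End Elimination.
Ltac comp_elim := first [ comp_elim1 | simple apply comp_pol_system | simple apply
  comp_satisfiable ].
Ltac comp_ext ::= first [comp_base | comp_qform | comp_pol | comp_tab | comp_elim].

Lemma comp_elim_exists {X} {EX : Enc X} (v : X -> nat * bool) (th : X -> qform rterm) :
  Comp v -> Comp th -> Comp (fun x => elim_exists (v x) (th x)).
Proof. by move=> cv cth; rewrite /elim_exists; comp. Qed.

Lemma comp_elim_quantifier {X} {EX : Enc X} (q : X -> quantifier) (v : X -> nat * bool)
    (th : X -> qform rterm) : Comp q -> Comp v -> Comp th ->
  Comp (fun x => elim_quantifier (q x) (v x) (th x)).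
Proof.
move=> cq cv cth; rewrite /elim_quantifier.
have c1 := comp_elim_exists cv cth; have c2 := comp_elim_exists cv (comp_Neg cth).
comp.
Qed.

Lemma computable_real_qe :
  computable_on code_rformula code_rqform (fun _ => True) real_qe.
Proof.
have [f rf fE] : Comp (fun p : seq (quantifier * (nat * bool)) * qform rterm =>
    foldr (fun qx th => elim_quantifier qx.1 qx.2 th) p.2 p.1).
  by apply: comp_foldr; try comp; apply: comp_elim_quantifier; comp.
exists (fun v => f (nth 0 v 0)); first exact: rf.
by move=> psi _; apply: (fE (quants psi, body psi)).
Qed.

(** * Real normal form *)

Definition czero := CConst qconst0.
Definition cone := CConst qconst1.

(** Real and imaginary parts are pushed down to the variables, so that both components are in real
    normal form. *)
Definition re_im : cterm -> cterm * cterm :=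
  cfold (fun z => (CRe (CVar z), CIm (CVar z))) (fun q => (CConst q, czero)) (czero, cone)
    (fun s t => (CAdd s.1 t.1, CAdd s.2 t.2))
    (fun s t => (CAdd (CMul s.1 t.1) (COpp (CMul s.2 t.2)),
                 CAdd (CMul s.1 t.2) (CMul s.2 t.1)))
    (fun t => (COpp t.1, COpp t.2)) (fun t => (t.1, czero)) (fun t => (t.2, czero))
    (fun t => (t.1, COpp t.2)).

(** Equality means equality of both parts and inequality a difference in at least one; order atoms
    are interpreted by [crel] on real parts. *)
Definition rnf_atom r s t : qform cterm :=
  let re := Atom r (CAdd (re_im s).1 (COpp (re_im t).1)) czero in
  let im := Atom r (CAdd (re_im s).2 (COpp (re_im t).2)) czero in
  match r with Eq => And [:: re; im] | Ne => Or [:: re; im] | Le => re | Lt => re end.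
Definition rnf_body : qform cterm -> qform cterm :=
  qfold rnf_atom Top Bot (@Neg _) (@And _) (@Or _) (@Imp _) (@Iff _).
Definition to_rnf (phi : cformula) : cformula := Prenex (quants phi) (rnf_body (body phi)).

Lemma re_im_rnf t : rnf_term (re_im t).1 && rnf_term (re_im t).2.
Proof.
elim: t => //= [s /andP[s1 s2] t /andP[t1 t2]|s /andP[s1 s2] t /andP[t1 t2]
  |t /andP[t1 t2]|t /andP[t1 t2]];
by rewrite ?s1 ?s2 ?t1 ?t2.
Qed.

Lemma re_im_vars t v :
  (v \in cvars (re_im t).1) || (v \in cvars (re_im t).2) ==> (v \in cvars t).
Proof.
elim: t => [z|q||s IHs t IHt|s IHs t IHt|t IHt|t IHt|t IHt|t IHt] //=;
  rewrite ?mem_cat ?in_nil ?orbF ?orbb ?implybb //.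
- by move: IHs IHt; do ![case: (v \in _)].
- by move: IHs IHt; do ![case: (v \in _)].
- by move: IHt; do ![case: (v \in _)].
- by move: IHt; do ![case: (v \in _)].
Qed.

Lemma rnf_body_normal f : qall (fun _ s t => rnf_term s /\ t = CConst qconst0) (rnf_body f).
Proof.
elim/qform_nested_ind: f => //= [r s t|fs IH|fs IH].
- have /andP[s1 s2] := re_im_rnf s; have /andP[t1 t2] := re_im_rnf t.
  by case: r; rewrite /= ?s1 ?s2 ?t1 ?t2.
- by elim: fs IH => //= f fs IHfs [IHf /IHfs IH]; split.
- by elim: fs IH => //= f fs IHfs [IHf /IHfs IH]; split.
Qed.

Lemma rnf_body_vars f : {subset qvars cvars (rnf_body f) <= qvars cvars f}.
Proof.
elim/qform_nested_ind: f => //= [r s t|fs IH|fs IH|f g IHf IHg|f g IHf IHg] v.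
- move: (re_im_vars s v) (re_im_vars t v).
  case: r; rewrite /= ?cats0 !mem_cat ?in_nil ?orbF; by do ![case: (v \in _)].
- by elim: fs IH => //= f fs IHfs [IHf /IHfs IH]; rewrite !mem_cat => /orP[/IHf|/IH] ->;
    rewrite ?orbT.
- by elim: fs IH => //= f fs IHfs [IHf /IHfs IH]; rewrite !mem_cat => /orP[/IHf|/IH] ->;
    rewrite ?orbT.
- by rewrite !mem_cat => /orP[/IHf|/IHg] ->; rewrite ?orbT.
- by rewrite !mem_cat => /orP[/IHf|/IHg] ->; rewrite ?orbT.
Qed.

Lemma eq_pholds (V : eqType) D (pre : seq (quantifier * V)) (M N : (V -> D) -> Prop) e :
  (forall e, M e <-> N e) -> pholds pre M e <-> pholds pre N e.
Proof.
move=> MN; elim: pre e => [|[[] v] pre IHpre] e /=; first exact: MN.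
  by split=> -[x /IHpre px]; exists x.
by split=> px x; apply/IHpre.
Qed.

Section RealNormalForm.
Local Open Scope ring_scope.
Local Open Scope complex_scope.
Variable R : realType.
Implicit Type e : nat -> R[i].

Lemma re_imE e t : ceval e (re_im t).1 = (complex.Re (ceval e t))%:C /\
  ceval e (re_im t).2 = (complex.Im (ceval e t))%:C.
Proof.
elim: t => //= [q||s [s1 s2] t [t1 t2]|s [s1 s2] t [t1 t2]|t [t1 t2]|t [t1 t2]|t [t1 t2]|t [t1 t2]].
- by rewrite rmorph0.
- by rewrite rmorph0 rmorph1.
- by rewrite s1 s2 t1 t2; case: (ceval e s) => a b; case: (ceval e t) => c d; simpc.
- by rewrite s1 s2 t1 t2; case: (ceval e s) => a b; case: (ceval e t) => c d; simpc.
- by rewrite ?t1 ?t2; case: (ceval e t) => a b; simpc; rewrite ?oppr0.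
- by rewrite ?t1 ?t2 rmorph0; case: (ceval e t) => a b.
- by rewrite ?t1 ?t2 rmorph0; case: (ceval e t) => a b.
- by rewrite ?t1 ?t2; case: (ceval e t) => a b; simpc; rewrite ?oppr0.
Qed.

Lemma rnf_atomE e r s t : cqholds e (rnf_atom r s t) = crel r (ceval e s) (ceval e t).
Proof.
have [s1 s2] := re_imE e s; have [t1 t2] := re_imE e t.
case: r; rewrite /cqholds /= ?s1 ?s2 ?t1 ?t2 rmorph0;
case: (ceval e s) => a b; case: (ceval e t) => c d; simpc; rewrite ?eq_complex /=.
- by rewrite !eqxx !andbT !subr_eq0.
- by rewrite !eqxx !andbT orbF !subr_eq0 negb_and.
- by rewrite subr_le0.
- by rewrite subr_lt0.
Qed.

Lemma rnf_bodyE e f : cqholds e (rnf_body f) = cqholds e f.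
Proof.
elim/qform_nested_ind: f => //= [r s t|f|fs IH|fs IH|f g|f g]; rewrite /cqholds /=.
- exact: rnf_atomE.
- by rewrite /cqholds => ->.
- by elim: fs IH => //= f fs IHfs [+ /IHfs->]; rewrite /cqholds => ->.
- by elim: fs IH => //= f fs IHfs [+ /IHfs->]; rewrite /cqholds => ->.
- by rewrite /cqholds => -> ->.
- by rewrite /cqholds => -> ->.
Qed.

Lemma to_rnfP phi : [/\ real_normal_form (to_rnf phi),
    {subset free_vars cvars (to_rnf phi) <= free_vars cvars phi} &
    forall e, cholds e phi <-> cholds e (to_rnf phi)].
Proof.
split; first exact: rnf_body_normal.
  move=> v; rewrite /free_vars !mem_filter /= => /andP[-> /rnf_body_vars].
  by [].
by move=> e; apply: eq_pholds => e'; rewrite rnf_bodyE.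
Qed.
End RealNormalForm.

Lemma comp_rnf_body {X} {EX : Enc X} (f : X -> qform cterm) :
  Comp f -> Comp (fun x => rnf_body (f x)).
Proof.
move=> cf; have cre Y (EY : Enc Y) (t : Y -> cterm) : Comp t -> Comp (fun y => re_im (t y)).
  by move=> ct; rewrite /re_im; comp.
rewrite /rnf_body; apply: comp_qfold; try comp.
rewrite /rnf_atom.
have c1 := cre _ _ (fun p : X * (relsym * (cterm * cterm)) => p.2.2.1) ltac:(comp).
have c2 := cre _ _ (fun p : X * (relsym * (cterm * cterm)) => p.2.2.2) ltac:(comp).
by apply: comp_relsym_case; comp.
Qed.

Lemma computable_to_rnf (D : cformula -> Prop) :
  computable_on code_cformula code_cformula D to_rnf.
Proof.
have [f rf fE] : Comp (fun p : seq (quantifier * nat) * qform cterm => (p.1, rnf_body p.2)).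
  by apply: comp_pair; [comp | apply: comp_rnf_body; comp].
exists (fun v => f (nth 0 v 0)); first exact: rf.
by move=> phi _; apply: (fE (quants phi, body phi)).
Qed.

(** * Splitting into real and imaginary parts *)

Definition qsplit (qs : seq (quantifier * nat)) : seq (quantifier * (nat * bool)) :=
  flatten [seq [:: (qv.1, (qv.2, false)); (qv.1, (qv.2, true))] | qv <- qs].

Section Split.
Local Open Scope ring_scope.
Local Open Scope complex_scope.
Variable R : realType.
Implicit Type e : nat -> R[i].

Definition split_env e : rvar -> R :=
  fun y => if y.2 then complex.Im (e y.1) else complex.Re (e y.1).

Lemma split_termE e t : rnf_term t -> ceval e t = (reval (split_env e) (split_term t))%:C.
Proof.
elim: t => //= [s IHs t IHt /andP[/IHs -> /IHt ->]|s IHs t IHt /andP[/IHs -> /IHt ->]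
  |t IHt /IHt ->|[] //|[] //].
- by rewrite rmorphD.
- by rewrite rmorphM.
- by rewrite rmorphN.
Qed.

Lemma crel_real r (a b : R) : crel r a%:C b%:C = rrel r a b.
Proof. by case: r => //=; rewrite eq_complex /= eqxx andbT. Qed.

Lemma split_bodyE e f : qall (fun _ s t => rnf_term s /\ t = CConst qconst0) f ->
  cqholds e f = rqholds (split_env e) (qmap split_term f).
Proof.
rewrite /cqholds /rqholds.
elim/qform_nested_ind: f => //= [r s t|f IH|fs IH|fs IH|f g IHf IHg|f g IHf IHg].
- by move=> [/split_termE -> ->]; rewrite crel_real.
- by move=> /IH ->.
- by elim: fs IH => //= f fs IHfs [IHf /IHfs IH] [/IHf-> /IH->].
- by elim: fs IH => //= f fs IHfs [IHf /IHfs IH] [/IHf-> /IH->].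
- by move=> [/IHf-> /IHg->].
- by move=> [/IHf-> /IHg->].
Qed.

(** This is why one complex quantifier can be exchanged for two real ones. *)
Lemma split_env_with e z a b : split_env [eta e with z |-> a +i* b] =
  [eta [eta split_env e with (z, false) |-> a] with (z, true) |-> b].
Proof.
apply/boolp.funext => -[y im]; rewrite /split_env /= !xpair_eqE.
by case: (y == z); case: im.
Qed.

Lemma split_formulaP e phi : real_normal_form phi ->
  cholds e phi <-> rholds (split_env e) (split_formula phi).
Proof.
case: phi => qs f; rewrite /real_normal_form /cholds /rholds /split_formula /= => nf.
elim: qs e => [|[[] z] qs IHqs] e /=; first by rewrite split_bodyE.
  split=> [[[a b] /IHqs]|[a [b]]].
    by rewrite split_env_with; exists a, b.
  by rewrite -split_env_with => /IHqs; exists (a +i* b).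
split=> [all_x a b|all_ab [a b]].
  by rewrite -split_env_with; apply/IHqs/all_x.
by apply/IHqs; rewrite split_env_with; apply: all_ab.
Qed.
End Split.

Lemma split_term_vars t y : y \in rvars (split_term t) -> y.1 \in cvars t.
Proof.
elim: t => //= [s IHs t IHt|s IHs t IHt|[] //= z _|[] //= z _].
- by rewrite !mem_cat => /orP[/IHs|/IHt] ->; rewrite ?orbT.
- by rewrite !mem_cat => /orP[/IHs|/IHt] ->; rewrite ?orbT.
- by rewrite !inE => /eqP ->.
- by rewrite !inE => /eqP ->.
Qed.

(** A bound variable has both of its parts bound after splitting, so a free part would come from a
    free variable of [phi]. *)
Lemma split_formula_closed phi :
  free_vars cvars phi = [::] -> free_vars rvars (split_formula phi) = [::].
Proof.
case: phi => qs f; rewrite /free_vars /split_formula /= => closed_phi.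
apply/eqP; rewrite -[_ == _]negbK -has_filter; apply/negP => /hasP[y yf ynqs].
have yf' : y.1 \in qvars cvars f.
  elim/qform_nested_ind: f yf {closed_phi} => //= [r s t|fs IH|fs IH|f g IHf IHg|f g IHf IHg].
  - by rewrite !mem_cat => /orP[/split_term_vars|/split_term_vars] ->; rewrite ?orbT.
  - by elim: fs IH => //= f fs IHfs [IHf /IHfs IH]; rewrite !mem_cat => /orP[/IHf|/IH] ->;
      rewrite ?orbT.
  - by elim: fs IH => //= f fs IHfs [IHf /IHfs IH]; rewrite !mem_cat => /orP[/IHf|/IH] ->;
      rewrite ?orbT.
  - by rewrite !mem_cat => /orP[/IHf|/IHg] ->; rewrite ?orbT.
  - by rewrite !mem_cat => /orP[/IHf|/IHg] ->; rewrite ?orbT.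
have : y.1 \in [seq v <- qvars cvars f | v \notin unzip2 qs].
  rewrite mem_filter yf' andbT; apply: contra ynqs; case: (y) => u im.
  elim: (qs) => //= -[q z] qs' IHqs /=; rewrite !inE => /predU1P[->|/IHqs ->].
    by rewrite !xpair_eqE eqxx; case: (im).
  by rewrite !orbT.
by rewrite closed_phi.
Qed.

(** * Variable-free formulas and the decision procedure *)

Definition ground_value : rterm -> rat :=
  rfold (fun=> 0%R) val +%R *%R (fun a => - a)%R.

(* [(a, (b, d))] stands for the rational number (a - b) / d. *)
Definition fraction_add (u v : nat * (nat * nat)) :=
  (u.1 * v.2.2 + v.1 * u.2.2, (u.2.1 * v.2.2 + v.2.1 * u.2.2, u.2.2 * v.2.2)).
Definition fraction_mul (u v : nat * (nat * nat)) :=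
  (u.1 * v.1 + u.2.1 * v.2.1, (u.1 * v.2.1 + u.2.1 * v.1, u.2.2 * v.2.2)).
Definition fraction_opp (u : nat * (nat * nat)) := (u.2.1, (u.1, u.2.2)).
Definition ground_fraction : rterm -> nat * (nat * nat) :=
  rfold (fun=> (0, (0, 1))) (fun q => (`|numq (val q)|, (0, `|denq (val q)|)))
    fraction_add fraction_mul fraction_opp.

(** The denominator of the fraction of [rsub s t] is positive, so its sign is found by comparing the
    two natural numbers of the numerator. *)
Definition ground_rel (r : relsym) (s t : rterm) : bool :=
  match r with
  | Eq => (ground_fraction (rsub s t)).1 == (ground_fraction (rsub s t)).2.1
  | Ne => (ground_fraction (rsub s t)).1 != (ground_fraction (rsub s t)).2.1
  | Le => (ground_fraction (rsub s t)).1 <= (ground_fraction (rsub s t)).2.1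
  | Lt => (ground_fraction (rsub s t)).1 < (ground_fraction (rsub s t)).2.1
  end.

Section Ground.
Local Open Scope ring_scope.
Local Open Scope complex_scope.

Lemma ratr_rat (q : rat) : ratr q = q.
Proof. by rewrite /ratr divq_num_den. Qed.

Lemma ground_valueE t : ceval (fun=> 0 : rat[i]) (join_term t) = (ground_value t)%:C.
Proof.
elim: t => //= [[z []] //|q|s -> t ->|s -> t ->|t ->].
- by rewrite ratr_rat.
- by rewrite rmorphD.
- by rewrite rmorphM.
- by rewrite rmorphN.
Qed.

Lemma reval_ground (R : realType) (e : rvar -> R) t : rvars t = [::] ->
  reval e t = ratr (ground_value t).
Proof.
elim: t => //= [s IHs t IHt|s IHs t IHt|t IHt].
- by case E: (rvars s) => // tE; rewrite IHs // IHt // rmorphD.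
- by case E: (rvars s) => // tE; rewrite IHs // IHt // rmorphM.
- by move=> /IHt ->; rewrite rmorphN.
Qed.

Definition fraction_value (u : nat * (nat * nat)) : rat := (u.1%:R - u.2.1%:R) / u.2.2%:R.

Lemma ground_fractionE t :
  (0 < (ground_fraction t).2.2)%N /\ ground_value t = fraction_value (ground_fraction t).
Proof.
elim: t => [y|q|s [s0 sE] t [t0 tE]|s [s0 sE] t [t0 tE]|t [t0 tE]].
- by rewrite /fraction_value /= subrr mul0r.
- rewrite /fraction_value /= absz_gt0 denq_neq0 subr0; split=> //.
  rewrite !pmulrn !gez0_abs ?denq_ge0 ?numq_ge0 ?divq_num_den //.
  exact: valP q.
- rewrite -[ground_value _]/(ground_value s + ground_value t) sE tE.
  rewrite -[ground_fraction (RAdd s t)]/(fraction_add (ground_fraction s) (ground_fraction t)).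
  move: (ground_fraction s) (ground_fraction t) s0 t0 => [a [b d]] [a' [b' d']] /= d0 d'0.
  rewrite muln_gt0 d0 d'0; split=> //; rewrite /fraction_value /= !natrD !natrM.
  by field; rewrite !pnatr_eq0 -!lt0n d0 d'0.
- rewrite -[ground_value _]/(ground_value s * ground_value t) sE tE.
  rewrite -[ground_fraction (RMul s t)]/(fraction_mul (ground_fraction s) (ground_fraction t)).
  move: (ground_fraction s) (ground_fraction t) s0 t0 => [a [b d]] [a' [b' d']] /= d0 d'0.
  rewrite muln_gt0 d0 d'0; split=> //; rewrite /fraction_value /= !natrD !natrM.
  by field; rewrite !pnatr_eq0 -!lt0n d0 d'0.
- rewrite -[ground_value _]/(- ground_value t) tE.
  by split=> //; rewrite /fraction_value /= -mulNr opprB.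
Qed.

Lemma ground_relE r s t :
  ground_rel r s t = crel r (ground_value s)%:C (ground_value t)%:C.
Proof.
have [d0 stE] := ground_fractionE (rsub s t).
have relE : forall a b : rat, crel r a%:C b%:C = crel r (a - b)%:C 0%:C.
  by move=> a b; case: r; rewrite /= ?eq_complex /= ?subr_eq0 ?subr_le0 ?subr_lt0.
rewrite relE -[ground_value s - ground_value t]/(ground_value (rsub s t)) stE /fraction_value.
set u := ground_fraction _ in d0 *.
have d1 : 0 < (u.2.2%:R : rat)^-1 by rewrite invr_gt0 ltr0n.
case: r {relE stE}; rewrite /= -/u ?eq_complex /= ?eqxx ?andbT.
- by rewrite mulf_eq0 (gt_eqF d1) orbF subr_eq0 eqr_nat.
- by rewrite mulf_eq0 (gt_eqF d1) orbF subr_eq0 eqr_nat.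
- by rewrite pmulr_lle0 // subr_le0 ler_nat.
- by rewrite pmulr_llt0 // subr_lt0 ltr_nat.
Qed.

Lemma eq_qholds_all T (I J : relsym -> T -> T -> bool) f :
  (forall r s t, I r s t = J r s t) -> qholds I f = qholds J f.
Proof.
by move=> IJ; congr (qholds _ f); do 3!(apply/boolp.funext => ?).
Qed.

Lemma qholds_qmap T U (h : T -> U) I f :
  qholds I (qmap h f) = qholds (fun r s t => I r (h s) (h t)) f.
Proof.
elim/qform_nested_ind: f => //= [f ->|fs IH|fs IH|f g -> ->|f g -> ->] //.
- by elim: fs IH => //= f fs IHfs [-> /IHfs->].
- by elim: fs IH => //= f fs IHfs [-> /IHfs->].
Qed.

Lemma ground_evalE f : ground_eval (qmap join_term f) = qholds ground_rel f.
Proof.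
rewrite /ground_eval /cqholds qholds_qmap; apply: eq_qholds_all => r s t.
by rewrite !ground_valueE ground_relE.
Qed.

(** Terms without variables take rational values, and the embedding of the rationals into [R] is
    injective and preserves and reflects the order. *)
Lemma ground_holds (R : realType) (e : rvar -> R) f : qvars rvars f = [::] ->
  rqholds e f = qholds ground_rel f.
Proof.
move=> closed_f.
have /qall_qvars : {subset qvars rvars f <= [::]} by rewrite closed_f.
apply: eq_qholds => r s t [s0 t0].
have nil (v : seq rvar) : {subset v <= [::]} -> v = [::].
  by case: v => // y v /(_ y); rewrite inE eqxx => /(_ isT).
rewrite (reval_ground _ (nil _ s0)) (reval_ground _ (nil _ t0)) ground_relE.
case: r => /=; rewrite ?eq_complex ?eqxx ?andbT /= ?ler_rat ?ltr_rat //.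
  by rewrite (inj_eq (fmorph_inj _)).
by rewrite (inj_eq (fmorph_inj _)).
Qed.
End Ground.

(** * Computability of the evaluation of variable-free formulas and of the splitting *)

Lemma comp_numq {X} {EX : Enc X} (q : X -> qconst) : Comp q -> Comp (fun x => `|numq (val (q x))|).
Proof. by apply: (comp_rec1 (F := fun q : qconst => `|numq (val q)|%N) rec1_chead) => q0;
  rewrite {1}/enc/= /enc_qconst /code_qconst codeE. Qed.

Lemma comp_denq {X} {EX : Enc X} (q : X -> qconst) : Comp q -> Comp (fun x => `|denq (val (q x))|).
Proof.
have rs : rec1 (fun n => chead (ctail n)) := recn_app1 rec1_chead rec1_ctail.
by apply: (comp_rec1 (F := fun q : qconst => `|denq (val q)|%N) rs) => q0;
  rewrite {1}/enc/= /enc_qconst /code_qconst !codeE.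
Qed.

Lemma comp_ground_fraction {X} {EX : Enc X} (t : X -> rterm) :
  Comp t -> Comp (fun x => ground_fraction (t x)).
Proof.
move=> ct; rewrite /ground_fraction; apply: comp_rfold;
  rewrite /fraction_add /fraction_mul /fraction_opp; try comp.
apply: comp_pair; first by apply: comp_numq; comp.
by apply: comp_pair; [comp | apply: comp_denq; comp].
Qed.

Lemma comp_ground {X} {EX : Enc X} (f : X -> qform rterm) :
  Comp f -> Comp (fun x => qholds ground_rel (f x)).
Proof.
move=> cf; apply: comp_qholds => //; rewrite /ground_rel.
have c1 : Comp (fun p : X * (relsym * (rterm * rterm)) => ground_fraction (rsub p.2.2.1 p.2.2.2)).
  by apply: comp_ground_fraction; comp.
by comp.
Qed.

(* The second component records whether a term is a variable, and which one. *)
Definition split_rec : cterm -> rterm * (bool * nat) :=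
  let d := RConst qconst0 in let no := (false, 0) in
  cfold (fun z => (d, (true, z))) (fun q => (RConst q, no)) (d, no)
    (fun s t => (RAdd s.1 t.1, no)) (fun s t => (RMul s.1 t.1, no))
    (fun t => (ROpp t.1, no))
    (fun t => (if t.2.1 then RVar (t.2.2, false) else d, no))
    (fun t => (if t.2.1 then RVar (t.2.2, true) else d, no))
    (fun t => (d, no)).

Lemma split_recE t : split_term t = (split_rec t).1.
Proof.
by elim: t => //= [s -> t ->|s -> t ->|t ->|[]|[]].
Qed.

Lemma comp_split_term {X} {EX : Enc X} (t : X -> cterm) :
  Comp t -> Comp (fun x => split_term (t x)).
Proof.
move=> ct; rewrite (_ : (fun x => _) = fun x => (split_rec (t x)).1).
  by rewrite /split_rec; comp.
by apply/boolp.funext => x; apply: split_recE.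
Qed.
Lemma comp_split : Comp (fun p : seq (quantifier * nat) * qform cterm =>
  (qsplit p.1, qmap split_term p.2)).
Proof.
rewrite /qsplit; apply: comp_pair; first by comp.
by apply: comp_qmap; [apply: comp_split_term; comp | comp].
Qed.

(** * Correctness of the procedure, completeness and decidability *)

Section Main.
Variable R : realType.

(** Truth is followed through normal form, splitting and real elimination. None of these adds free
    variables, so a sentence ends in a variable-free formula, whose value in the rationals is the
    one in [R]. *)
Lemma pseudo_complex_qeP rnf rqe : rnf_procedure R rnf -> real_qe_procedure R rqe ->
  forall phi, sentence R phi -> forall e : nat -> R[i],
    cholds e phi <-> ground_eval (pseudo_complex_qe rnf rqe phi).
Proof.
move=> [_ rnfP] [_ rqeP] phi [wf closed_phi] e.
have [nf sub ->] := rnfP phi wf.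
have closed_rnf : free_vars cvars (rnf phi) = [::].
  by rewrite closed_phi in sub; case: (free_vars _ _) sub => // y v /(_ y);
    rewrite inE eqxx => /(_ isT).
rewrite split_formulaP //; have [qsub ->] := rqeP (split_formula (rnf phi)).
rewrite split_formula_closed // in qsub.
rewrite ground_holds ?ground_evalE //.
by case: (qvars _ _) qsub => // y v /(_ y); rewrite inE eqxx => /(_ isT).
Qed.

(** Composes the given algorithms with the splitting and the ground evaluation. By [ground_evalE]
    the value of the joined formula can be computed directly on the output of [rqe]. *)
Lemma pseudo_complex_qe_computable rnf rqe :
    rnf_procedure R rnf -> real_qe_procedure R rqe ->
  computable_on code_cformula nat_of_bool (sentence R)
    (fun phi => ground_eval (pseudo_complex_qe rnf rqe phi)).
Proof.
move=> [[frnf rec_rnf rnfE] _] [[frqe rec_rqe rqeE] _].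
have [fs rs sE] := comp_split.
have [fg rg gE] := comp_ground (comp_id (X := qform rterm)).
have rec1_tuple f : recursive f -> rec1 (fun n => f [tuple n]).
  apply: eq_recursive => v; congr f; case/tupleP: v => n v.
  by apply: val_inj; rewrite /= tuple0.
exists (fun v => fg (frqe [tuple fs (frnf [tuple nth 0 v 0])])).
  exact: (recn_app1 rg (recn_app1 (rec1_tuple _ rec_rqe) (recn_app1 rs (rec1_tuple _ rec_rnf)))).
move=> phi [wf _] /=; rewrite rnfE //.
have -> : fs (code_cformula (rnf phi)) = code_rformula (split_formula (rnf phi)).
  exact: (sE (quants (rnf phi), body (rnf phi))).
by rewrite rqeE // /pseudo_complex_qe ground_evalE; apply: gE.
Qed.

(** Classical De Morgan laws along the quantifier prefix. *)
Lemma pholds_dual (V : eqType) D (pre : seq (quantifier * V)) (M : (V -> D) -> Prop) e :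
  pholds [seq (dual qv.1, qv.2) | qv <- pre] (fun e' => ~ M e') e <-> ~ pholds pre M e.
Proof.
elim: pre e => [|[[] v] pre IHpre] e //=.
  rewrite -boolp.forallNP; split=> nx x; exact/IHpre.
rewrite -boolp.existsNP; split=> -[x /IHpre nx]; by exists x.
Qed.

Lemma cholds_pneg e (phi : cformula) : cholds e (pneg phi) <-> ~ @cholds R e phi.
Proof.
rewrite -pholds_dual; apply: eq_pholds => e'; rewrite /cqholds /=.
by split=> /negP.
Qed.

Lemma sentence_pneg phi : sentence R phi -> sentence R (pneg phi).
Proof.
move=> [wf closed_phi]; split=> //; rewrite -closed_phi /free_vars /=.
by rewrite /unzip2 -map_comp.
Qed.
End Main.

Lemma to_rnf_procedure (R : realType) : rnf_procedure R to_rnf.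
Proof. by split=> [|phi _]; [exact: computable_to_rnf | exact: to_rnfP]. Qed.

Lemma real_qe_is_procedure (R : realType) : real_qe_procedure R real_qe.
Proof.
by split=> [|psi]; [exact: computable_real_qe | split; [exact: real_qe_vars | move=> e;
  exact: real_qeP]].
Qed.

Theorem corollary1 (R : realType) :
  [/\ complete R (Theta R),
      decidable_theory R (Theta R),
      (exists rnf, rnf_procedure R rnf) /\ (exists rqe, real_qe_procedure R rqe) &
      forall (rnf : cformula -> cformula) (rqe : rformula -> rqform),
        rnf_procedure R rnf -> real_qe_procedure R rqe ->
        decision_procedure R (Theta R)
          (fun phi => ground_eval (pseudo_complex_qe rnf rqe phi))].
Proof.
have rnfR := to_rnf_procedure R; have rqeR := real_qe_is_procedure R.
have decide rnf rqe : rnf_procedure R rnf -> real_qe_procedure R rqe ->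
    decision_procedure R (Theta R)
      (fun phi => ground_eval (pseudo_complex_qe rnf rqe phi)).
  move=> rnfP rqeP; split; first exact: pseudo_complex_qe_computable.
  move=> phi sphi; have holdsE := pseudo_complex_qeP rnfP rqeP sphi.
  (* Membership in [Theta] gives truth in every environment, of which the zero one is taken;
     conversely the answer of the procedure does not depend on the environment. *)
  by split=> [/holdsE phiT|[_ phiT]]; [|apply/(holdsE (fun=> 0%R))].
split; last exact: decide.
- move=> phi sphi; have holdsE := pseudo_complex_qeP rnfR rqeR sphi.
  (* Completeness is read off the Boolean answer: if it is false, the sentence fails in every
     environment, so its negation holds in all of them. *)
  case E: (ground_eval (pseudo_complex_qe to_rnf real_qe phi)); [left|right].
    by split=> // e; apply/holdsE.
  by split=> [|e]; [exact: sentence_pneg | apply/cholds_pneg => /holdsE; rewrite E].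
- by eexists; apply: decide rnfR rqeR.
- by split; [exists to_rnf | exists real_qe].
Qed.
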